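(* There is a universal constant $c>0$ such that, for every integer $K\ge2$, $$\beta(K)\ge cK^{1/4}.$$
   Context: $M_K(\mathbb C)$ is the algebra of complex $K\times K$ matrices and $M_K^0=\{A\in M_K(\mathbb C):\operatorname{tr}A=0\}$. A normalized local basis is a family $\mathcal B=\{B_0=I,B_1,\ldots,B_{K^2-1}\}$ that is an orthonormal basis of $M_K(\mathbb C)$ for $\langle A,B\rangle=\frac1K\operatorname{tr}(AB^* )$ (so $B_\mu\in M_K^0$ for $\mu\ge1$). For $\beta\in\{0,\ldots,K^2-1\}^n$ put $B_\beta=B_{\beta_1}\otimes\cdots\otimes B_{\beta_n}$, and for $A\in M_K(\mathbb C)^{\otimes n}\cong M_{K^n}(\mathbb C)$ let $\widehat A_{\mathcal B}(\beta)=K^{-n}\operatorname{tr}(AB_\beta^* )$, so $A=\sum_\beta\widehat A_{\mathcal B}(\beta)B_\beta$; $\|\widehat A_{\mathcal B}\|_{\ell_p}=(\sum_\beta|\widehat A_{\mathcal B}(\beta)|^p)^{1/p}$, and $\|\cdot\|_{\mathrm{op}}$ is the operator norm. For $S\subset[n]$ let $\mathcal H_S=(\bigotimes_{j\in S}M_K^0)\otimes(\bigotimes_{j\notin S}\mathbb CI)$ and $\mathcal H_{d,K}(n)=\bigoplus_{|S|=d}\mathcal H_S$. With $p_d=\frac{2d}{d+1}$, $C_{d,K}$ is the least constant, uniform in $n$ and in the choice of the normalized local basis $\mathcal B$, such that $\|\widehat A_{\mathcal B}\|_{\ell_{p_d}}\le C_{d,K}\|A\|_{\mathrm{op}}$ for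 all $A\in\mathcal H_{d,K}(n)$; and $\beta(K)=\limsup_{d\to\infty}C_{d,K}^{1/d}$. *)

(* Defs.v *)
From HB Require Import structures.
From mathcomp Require Import all_boot all_order all_algebra.
From mathcomp Require Import complex mxtens.
From mathcomp Require Import all_classical all_reals all_analysis.

Set Implicit Arguments.
Unset Strict Implicit.
Unset Printing Implicit Defensive.

Import Order.TTheory GRing.Theory Num.Theory.
Import numFieldNormedType.Exports.

Local Open Scope classical_set_scope.
Local Open Scope ring_scope.
Local Open Scope complex_scope.
Local Open Scope sesquilinear_scope.

Section Defs.
Variable R : realType.
Implicit Types d n K m : nat.

(* The norm of R[i] takes its values in R[i]; cabs is the real number |z|. *)
Definition cabs (z : R[i]) : R := complex.Re `|z|.

Definition l2norm m (v : 'cV[R[i]]_m) : R :=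
  Num.sqrt (\sum_(i < m) cabs (v i 0) ^+ 2).

Definition opnorm m (A : 'M[R[i]]_m) : R :=
  sup [set l2norm (A *m v) | v in [set v : 'cV[R[i]]_m | l2norm v <= 1]].

(* As for ntensmx in mxtens, the recursion starts at n = 1, where K ^ 1 is
   convertible to K; no cast between dimensions is then needed. *)
Fixpoint tensor_rec K n : ('I_n.+1 -> 'M[R[i]]_K) -> 'M[R[i]]_(K ^ n.+1) :=
  match n with
  | 0 => fun X => X ord0
  | n'.+1 => fun X => X ord0 *t tensor_rec (fun j => X (lift ord0 j))
  end.

Definition tensor K n : ('I_n -> 'M[R[i]]_K) -> 'M[R[i]]_(K ^ n) :=
  match n with
  | 0 => fun _ => 1%:M
  | n'.+1 => @tensor_rec K n'
  end.

Definition hs_inner K (A B : 'M[R[i]]_K) : R[i] := K%:R^-1 * \tr (A *m B^t*).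

Definition normalized_local_basis K (B : 'I_(K ^ 2) -> 'M[R[i]]_K) : Prop :=
  [/\ forall mu, nat_of_ord mu = 0%N -> B mu = 1%:M,
      forall mu nu, hs_inner (B mu) (B nu) = (mu == nu)%:R
    & basis_of fullv (codom B)].

Definition fourier_coef K n (B : 'I_(K ^ 2) -> 'M[R[i]]_K)
    (A : 'M[R[i]]_(K ^ n)) (b : {ffun 'I_n -> 'I_(K ^ 2)}) : R[i] :=
  (K%:R ^+ n)^-1 * \tr (A *m (tensor (fun j => B (b j)))^t*).

Definition fourier_lp K n (B : 'I_(K ^ 2) -> 'M[R[i]]_K)
    (A : 'M[R[i]]_(K ^ n)) (p : R) : R :=
  (\sum_(b : {ffun 'I_n -> 'I_(K ^ 2)}) cabs (fourier_coef B A b) `^ p)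
    `^ p^-1.

Definition in_factor K n (S : {set 'I_n}) (X : 'I_n -> 'M[R[i]]_K) : Prop :=
  forall j, if j \in S then \tr (X j) = 0 else is_scalar_mx (X j).

(* H_S, as the linear span of its elementary tensors. *)
Definition HS K n (S : {set 'I_n}) : set 'M[R[i]]_(K ^ n) :=
  [set A | exists (r : nat) (a : 'I_r -> R[i])
             (X : 'I_r -> 'I_n -> 'M[R[i]]_K),
    (forall k, in_factor S (X k)) /\
    A = \sum_(k < r) a k *: tensor (X k)].

(* The sum of the H_S is always direct, so the direct sum is the plain sum. *)
Definition homogeneous d K n : set 'M[R[i]]_(K ^ n) :=
  [set A | exists F : {set 'I_n} -> 'M[R[i]]_(K ^ n),
    (forall S : {set 'I_n}, #|S| = d -> HS S (F S)) /\
    A = \sum_(S : {set 'I_n} | #|S| == d) F S].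

Definition p_exp d : R := (2 * d)%:R / d.+1%:R.

(* The set of admissible constants is closed in R, so the infimum is the least
   one when there is one; it is +oo when there is none. *)
Definition bh_const d K : \bar R :=
  ereal_inf [set C%:E | C in [set C : R |
    forall n (B : 'I_(K ^ 2) -> 'M[R[i]]_K), normalized_local_basis B ->
    forall A : 'M[R[i]]_(K ^ n), homogeneous d A ->
      fourier_lp B A (p_exp d) <= C * opnorm A]].

Definition bh_growth K : \bar R :=
  limn_esup (fun d => poweR (bh_const d K) d%:R^-1).

End Defs.

(* Main.v *)
Require Import Defs.
From HB Require Import structures.
From mathcomp Require Import all_boot all_order all_algebra.
From mathcomp Require Import cyclic separable cyclotomic.
From mathcomp Require Import complex mxtens.
From mathcomp Require Import ring lra zify.
From mathcomp Require Import all_classical all_reals all_analysis.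

(** Let L be of order K and fix L basis elements of M_K, spanning a subspace on
    which the operator norm is at most a constant times the normalized
    Hilbert-Schmidt norm; random symmetric sign matrices span such a subspace.
    Put Y_0 = 1 and, on a fresh block of L ^ t sites indexed by i,
      Y_{t+1,(i,w)} = (\sum_k V_{ik} Y_{t,k}) (x) B_w at site i,
    where V is a Fourier matrix with unimodular entries.  In a combination
    \sum_i Y'_i (x) X_i each site of the new block occurs linearly and only once,
    so the Hermitian parts of the X_i can be replaced one site after the other by
    eigenvalues, which are scalars of size O(|X_i|).  Hence the bound w_t of
    |\sum_k a_k Y_{t,k}| over unit vectors a satisfies
    w_{t+1} <= C L ^ (t/2) w_t.  The operator \sum_k Y_{d,k} has
    N = L ^ (d(d+1)/2) Fourier coefficients, all of modulus 1, and norm at most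
    C ^ d sqrt N.  So C_{d,K} >= N ^ (1/(2d)) / C ^ d >= (L ^ (1/4) / C) ^ d. *)

Set Implicit Arguments.
Unset Strict Implicit.
Unset Printing Implicit Defensive.

Import Order.TTheory GRing.Theory Num.Theory.
Import numFieldNormedType.Exports.

Local Open Scope ring_scope.

(** * Rounding to a grid and exponential moments of signs *)

Section RealSums.
Variable R : realType.

(** Since 1 / p_d = 1/2 + 1 / (2d), N coefficients of modulus 1 have l_{p_d} norm sqrt N *
    N^(1/(2d)). The normalized Hilbert-Schmidt norm is already sqrt N, so the gain is N^(1/(2d)),
    provided the operator norm stays below C^d sqrt N. This gain is exponential in d only if log N
    is quadratic in d, which is why the blocks grow geometrically. The risk is the cost of mixing
    the L^t operators of a block. Once the new sites are replaced by eigenvalues mu, what remains is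
    a combination of the Y_{t,k} with coefficient vector V^T mu. A Fourier matrix is sqrt (L^t)
    times a unitary, so this vector has norm L^(t/2) |mu|, while the unimodular entries keep all
    Fourier coefficients flat. Symmetry of the sign matrices makes their real combinations
    Hermitian, which supplies the eigenvalues; a complex combination is H1 + i H2 with H1 and H2 of
    this kind. Probability is done by counting: expectations are sums over finitely many sign
    patterns, and the net of the usual union bound is an integer grid with Gaussian weights. *)

Lemma cauchy_schwarz_sum (I : finType) (a b : I -> R) :
  (\sum_i a i * b i) ^+ 2 <= (\sum_i a i ^+ 2) * (\sum_i b i ^+ 2).
Proof.
have : 0 <= \sum_i \sum_j (a i * b j - a j * b i) ^+ 2.
  by apply: sumr_ge0 => i _; apply: sumr_ge0 => j _; exact: sqr_ge0.
have -> : \sum_i \sum_j (a i * b j - a j * b i) ^+ 2 =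
   (\sum_i a i ^+ 2) * (\sum_i b i ^+ 2) *+ 2 - (\sum_i a i * b i) ^+ 2 *+ 2.
  have E1 : (\sum_i a i ^+ 2) * (\sum_i b i ^+ 2) =
      \sum_i \sum_j a i ^+ 2 * b j ^+ 2.
    by rewrite mulr_suml; apply: eq_bigr => i _; rewrite mulr_sumr.
  have E2 : (\sum_i a i * b i) ^+ 2 = \sum_i \sum_j (a i * b i) * (a j * b j).
    by rewrite expr2 mulr_suml; apply: eq_bigr => i _; rewrite mulr_sumr.
  have E3 : (\sum_i a i ^+ 2) * (\sum_i b i ^+ 2) =
      \sum_i \sum_j a j ^+ 2 * b i ^+ 2 by rewrite E1 exchange_big.
  rewrite mulr2n {1}E1 E3 E2 mulr2n opprD -!sumrN -!big_split /=.
  apply: eq_bigr => i _; rewrite -!sumrN -!big_split /=.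
  by apply: eq_bigr => j _; ring.
by rewrite subr_ge0 lerMn2r.
Qed.

(** Only e^y >= 1 + y is used. For x^2 <= 1/2, e^y <= 1 / (1 - y) at y = x and y = - x gives 2 / (1
    - x^2) <= 2 (1 + 2 x^2); for larger x, already |x| <= 2 x^2. The sharp exponent would be x^2 /
    2. *)
Lemma expR_cosh_le (x : R) : expR x + expR (- x) <= 2 * expR (2 * x ^+ 2).
Proof.
have [x2|x2] := lerP (x ^+ 2) 2^-1.
  have inv (y : R) : y < 1 -> expR y <= (1 - y)^-1.
    move=> y1; rewrite -[expR y]invrK -expRN lef_pV2 ?posrE ?subr_gt0 ?expR_gt0//.
    exact: expR_ge1Dx.
  have x1 : x < 1.
    rewrite ltNge; apply/negP => x1.
    by have := exprn_ege1 2 x1; lra.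
  have x1' : - x < 1.
    rewrite ltNge; apply/negP => x1'.
    by have := exprn_ege1 2 x1'; rewrite sqrrN; lra.
  have := lerD (inv _ x1) (inv _ x1') => /le_trans; apply.
  have -> : (1 - x)^-1 + (1 - - x)^-1 = 2 * (1 - x ^+ 2)^-1.
    have h1 : 1 - x ^+ 2 = (1 - x) * (1 + x) by ring.
    by rewrite h1; field; apply/andP; split; lra.
  rewrite ler_pM2l//; apply: le_trans (expR_ge1Dx _).
  by rewrite -div1r ler_pdivrMr; nra.
have H (y : R) : 2^-1 < y ^+ 2 -> expR y <= expR (2 * y ^+ 2).
  by move=> y2; rewrite ler_expR; nra.
rewrite mulr_natl mulr2n lerD ?H//.
by rewrite -[in leRHS]sqrrN H// sqrrN.
Qed.

Definition sg (b : bool) : R := (-1) ^+ b.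

(** Independence of the signs: the sum over all patterns factors over [T]. Dividing by the number of
    patterns gives the subgaussian moment bound. *)
Lemma signs_mgf (T : finType) (c : T -> R) :
  \sum_(e : {ffun T -> bool}) expR (\sum_t sg (e t) * c t)
  <= #|{ffun T -> bool}|%:R * expR (2 * \sum_t c t ^+ 2).
Proof.
under eq_bigr do rewrite expR_sum.
rewrite -(bigA_distr_bigA (fun t b => expR (sg b * c t))) /=.
have -> : #|{ffun T -> bool}|%:R * expR (2 * \sum_t c t ^+ 2)
    = \prod_t (2 * expR (2 * c t ^+ 2)) :> R.
  by rewrite big_split/= prodr_const card_ffun card_bool natrX mulr_sumr expR_sum.
apply: ler_prod => t _; rewrite big_bool /sg /= expr1 expr0 mul1r mulN1r.
by rewrite addr_ge0 ?expR_ge0// addrC expR_cosh_le.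
Qed.

(** The integers from -B to B. The size is written [B + B.+1] so that a sum over the grid splits
    into negative and nonnegative points. *)
Definition gridv (B : nat) (g : 'I_(B + B.+1)) : R := (g%:R - B%:R).

Lemma grid_weight (B : nat) : \sum_(g < B + B.+1) expR (- gridv g ^+ 2) <= 3.
Proof.
have geo n : \sum_(j < n) (2^-1 : R) ^+ j = 2 - 2 * 2^-1 ^+ n.
  elim: n => [|n IH]; first by rewrite big_ord0 expr0; lra.
  by rewrite big_ord_recr /= IH exprS; lra.
have e2 : expR (-1) <= 2^-1 :> R.
  rewrite expRN lef_pV2 ?posrE ?expR_gt0//.
  by have := expR_ge1Dx (1 : R); lra.
have le (z : R) (n : nat) : z ^+ 2 = n%:R ^+ 2 -> expR (- z ^+ 2) <= 2^-1 ^+ n.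
  move=> ->; apply: (@le_trans _ _ (expR (-1 *+ n))).
    rewrite ler_expR mulNrn lerN2 -natrX ler_nat; case: n => // n.
    by rewrite expnS expn1 leq_pmulr.
  by rewrite -[_ *+ n]mulr_natl expRM_natl; apply: lerXn2r => //; rewrite ?nnegrE
    ?expR_ge0.
rewrite big_split_ord /=.
have -> : 3 = 1 + 2 :> R by lra.
apply: lerD.
  rewrite (reindex_inj rev_ord_inj) /=.
  apply: (@le_trans _ _ (\sum_(i < B) 2^-1 * 2^-1 ^+ i)).
    apply: ler_sum => i _; rewrite -exprS; apply: le; rewrite /gridv /=.
    by rewrite natrB// -[RHS]sqrrN; congr (_ ^+ 2); lra.
  rewrite -mulr_sumr geo; have : 0 <= (2^-1 : R) ^+ B by rewrite exprn_ge0.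
  by lra.
apply: (@le_trans _ _ (\sum_(i < B.+1) 2^-1 ^+ i)).
  by apply: ler_sum => i _; apply: le; rewrite /gridv /= natrD; congr (_ ^+ 2); lra.
have h : 0 <= (2^-1 : R) ^+ B.+1 by rewrite exprn_ge0.
by rewrite geo; lra.
Qed.

(** Replaces counting the points of a net: a point with squared norm at most 10 n keeps weight at
    least e^(-10 n), while the whole grid has weight at most 3^n <= e^(2n). *)
Lemma grid_weights (n B : nat) :
  \sum_(z : {ffun 'I_n -> 'I_(B + B.+1)}) expR (- \sum_i gridv (z i) ^+ 2)
  <= expR (2 * n%:R).
Proof.
under eq_bigr do rewrite -sumrN expR_sum.
rewrite -(bigA_distr_bigA (fun (_ : 'I_n) g => expR (- gridv g ^+ 2))) /=.
have -> : expR (2 * n%:R) = \prod_(i < n) expR 2 :> R.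
  by rewrite prodr_const card_ord -expRM_natl mulrC.
apply: ler_prod => i _; rewrite sumr_ge0 /=; last by move=> ? _; exact: expR_ge0.
by apply: le_trans (grid_weight _) _; have := expR_ge1Dx (2 : R); lra.
Qed.

(* Applying the hypothesis to a rounding of f / |f| bounds |f| by m + |f| / 2. *)
Lemma grid_norm (n : nat) (f : 'I_n -> R) (m : R) :
  (forall z : {ffun 'I_n -> 'I_((2 * n) + (2 * n).+1)},
     \sum_i gridv (z i) ^+ 2 <= 10 * n%:R ->
     \sum_i f i * gridv (z i) <= m * (2 * Num.sqrt n%:R)) ->
  \sum_i f i ^+ 2 <= 4 * m ^+ 2.
Proof.
move=> H.
case: n f H => [|n] f H; first by rewrite big_ord0 mulr_ge0 ?sqr_ge0.
set N := n.+1 in f H *.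
set S := \sum_i f i ^+ 2.
have S0 : 0 <= S by apply: sumr_ge0 => i _; exact: sqr_ge0.
have [->|Sn0] := eqVneq S 0; first by rewrite mulr_ge0 ?sqr_ge0.
have Sp : 0 < S by rewrite lt_neqAle eq_sym Sn0.
set s := Num.sqrt S; have sp : 0 < s by rewrite sqrtr_gt0.
have sE : s ^+ 2 = S by rewrite sqr_sqrtr.
set r := Num.sqrt (N%:R : R); have rp : 0 < r by rewrite sqrtr_gt0 ltr0n.
have rE : r ^+ 2 = N%:R by rewrite sqr_sqrtr ?ler0n.
have rN : r <= N%:R.
  have r1 : 1 <= r by rewrite /r -[leLHS]sqrtr1 ler_wsqrtr// ler1n.
  by rewrite -rE; nra.
(* [f] rescaled to norm 2 sqrt N, twice the largest possible rounding error sqrt N. Its coordinates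
   are at most 2 sqrt N <= 2N, hence within the grid, and its rounding has squared norm at most 2 *
   4N + 2N = 10 N. *)
pose y i := 2 * r * f i / s.
have y2 : \sum_i y i ^+ 2 = 4 * N%:R.
  rewrite (eq_bigr (fun i => (4 * N%:R / S) * f i ^+ 2)); last first.
    by move=> i _; rewrite /y -rE -sE; field; lra.
  by rewrite -mulr_sumr -/S; field.
have fs i : `|f i / s| <= 1.
  rewrite normrM normfV (gtr0_norm sp) ler_pdivrMr// mul1r -sqrtr_sqr ler_wsqrtr//.
  by rewrite /S (bigD1 i)//= lerDl sumr_ge0// => j _; exact: sqr_ge0.
have yb i : - (2 * N)%:R <= y i <= (2 * N)%:R.
  rewrite -ler_norml /y -mulrA normrM gtr0_norm ?mulr_gt0// natrM.
  rewrite (@le_trans _ _ (2 * r * 1))// ?ler_pM2l ?mulr_gt0//.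
  by rewrite mulr1 ler_pM2l.
have gi i : exists g : 'I_((2 * N) + (2 * N).+1), 0 <= y i - gridv g <= 1.
  have /andP[yb1 yb2] := yb i.
  have h0 : 0 <= y i + (2 * N)%:R by lra.
  have /andP[t1 t2] := truncn_itv h0.
  have tlt : (Num.truncn (y i + (2 * N)%:R) < (2 * N) + (2 * N).+1)%N.
    rewrite addnS ltnS -(ler_nat R); apply: le_trans t1 _.
    by rewrite natrD lerD2r.
  exists (Ordinal tlt); rewrite /gridv /=.
  move: t2; rewrite -natr1.
  by move: t1; set t := (Num.truncn _)%:R => t1 t2; apply/andP; split; lra.
have [g gP] := choice gi.
pose z := [ffun i => g i].
have zE i : z i = g i by rewrite ffunE.
have /H : \sum_i gridv (z i) ^+ 2 <= 10 * N%:R.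
  apply: (@le_trans _ _ (\sum_i (2 * y i ^+ 2 + 2))).
    apply: ler_sum => i _; rewrite zE; have := gP i.
    move: (gridv _) (y i) => a b /andP[h1 h2].
    have h3 : (b - a) ^+ 2 <= 1 by rewrite expr_le1.
    by have := sqr_ge0 (b + (b - a)); nra.
  by rewrite big_split /= -mulr_sumr y2 sumr_const card_ord -mulr_natr; lra.
rewrite -/r => Hz.
pose e i := y i - gridv (z i).
have e2 : \sum_i e i ^+ 2 <= N%:R.
  apply: (@le_trans _ _ (\sum_(i < N) 1)); last by rewrite sumr_const card_ord.
  apply: ler_sum => i _; rewrite /e zE; have /andP[h1 h2] := gP i.
  by rewrite expr_le1.
have fe : \sum_i f i * e i <= s * r.
  have := cauchy_schwarz_sum f e; rewrite -/S -sE => h.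
  have h2 : (\sum_i f i * e i) ^+ 2 <= (s * r) ^+ 2.
    by apply: le_trans h _; rewrite exprMn rE ler_wpM2l// sqr_ge0.
  apply: le_trans (ler_norm _) _.
  by rewrite -(ger0_norm (ltW (mulr_gt0 sp rp))) -ler_sqr ?nnegrE ?normr_ge0//
    !real_normK ?num_real.
have fy : \sum_i f i * y i = 2 * r * s.
  rewrite (eq_bigr (fun i => (2 * r / s) * f i ^+ 2)); last first.
    by move=> i _; rewrite /y; field; lra.
  by rewrite -mulr_sumr -/S -sE; field; lra.
have sum : \sum_i f i * y i = \sum_i f i * gridv (z i) + \sum_i f i * e i.
  by rewrite -big_split /=; apply: eq_bigr => i _; rewrite -mulrDr /e; congr (_ * _);
    lra.
have : 2 * r * s <= m * (2 * r) + s * r by rewrite -fy sum lerD.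
have -> : m * (2 * r) + s * r = r * (2 * m + s) by ring.
have -> : 2 * r * s = r * (2 * s) by ring.
rewrite ler_pM2l// => h.
have s2m : s <= 2 * m by lra.
rewrite -sE; have -> : 4 * m ^+ 2 = (2 * m) ^+ 2 by ring.
by rewrite ler_sqr ?nnegrE ?(ltW sp)// (le_trans (ltW sp)).
Qed.

End RealSums.

(** * Random symmetric sign tensors *)

Section RandomTensor.
Variable R : realType.
Variables L K : nat.
Implicit Types (tau : {ffun 'I_L * 'I_K * 'I_K -> bool}) (a : 'I_L -> R) (u v : 'I_K
  -> R).

(** Symmetry makes real combinations of the slices Hermitian; the zero diagonal makes each slice
    traceless, so that it can stand in a local basis beside the identity. *)
Definition sym_signs tau (w : 'I_L) (x y : 'I_K) : R :=
  if (x < y)%N then sg R (tau (w, x, y))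
  else if (y < x)%N then sg R (tau (w, y, x)) else 0.

Definition tri (s : 'I_L -> 'I_K -> 'I_K -> R) a u v :=
  \sum_w \sum_x \sum_y a w * u x * v y * s w x y.

(** The coefficient of one independent sign in the trilinear form: the entries at (x, y) and (y, x)
    share their sign, so their contributions are merged at x < y. *)
Definition tri_coef a u v (t : 'I_L * 'I_K * 'I_K) : R :=
  if (t.1.2 < t.2)%N then a t.1.1 * (u t.1.2 * v t.2 + u t.2 * v t.1.2) else 0.

Lemma sg_sqr b : sg R b * sg R b = 1.
Proof. by rewrite /sg -expr2 sqrr_sign. Qed.

Lemma sgN b : sg R (~~ b) = - sg R b.
Proof. by rewrite /sg signrN. Qed.

Lemma sum_triple (F : 'I_L -> 'I_K -> 'I_K -> R) :
  \sum_(t : 'I_L * 'I_K * 'I_K) F t.1.1 t.1.2 t.2 = \sum_w \sum_x \sum_y F w x y.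
Proof.
rewrite -(pair_bigA _ (fun p y => F p.1 p.2 y)) /=.
by rewrite -(pair_bigA _ (fun w x => \sum_y F w x y)).
Qed.

Lemma sum_sym (F : 'I_K -> 'I_K -> R) : (forall x, F x x = 0) ->
  \sum_(x < K) \sum_(y < K) F x y = \sum_(x < K) \sum_(y < K) (if (x < y)%N then F x
    y + F y x else 0).
Proof.
move=> F0.
have -> : \sum_(x < K) \sum_(y < K) (if (x < y)%N then F x y + F y x else 0) =
    \sum_(x < K) \sum_(y < K) (if (x < y)%N then F x y else 0) +
    \sum_(x < K) \sum_(y < K) (if (x < y)%N then F y x else 0).
  rewrite -big_split; apply: eq_bigr => x _; rewrite -big_split /=.
  by apply: eq_bigr => y _; case: ifP; rewrite ?addr0.
rewrite [X in _ + X]exchange_big /= -big_split /=.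
apply: eq_bigr => x _; rewrite -big_split /=; apply: eq_bigr => y _.
case: ltngtP => [||/val_inj ->]; rewrite ?addr0 ?add0r//; exact: F0.
Qed.

Lemma tri_signs tau a u v :
  tri (sym_signs tau) a u v = \sum_t sg R (tau t) * tri_coef a u v t.
Proof.
rewrite (eq_bigr (fun t : 'I_L * 'I_K * 'I_K =>
  (fun w x y => sg R (tau (w, x, y)) * tri_coef a u v (w, x, y)) t.1.1 t.1.2 t.2));
  last by case=> [[w x] y] _.
rewrite (sum_triple (fun w x y => sg R (tau (w, x, y)) * tri_coef a u v (w, x, y))).
apply: eq_bigr => w _.
rewrite sum_sym; last by move=> x; rewrite /sym_signs ltnn mulr0.
apply: eq_bigr => x _; apply: eq_bigr => y _.
rewrite /tri_coef /=; case: ifP => xy; last by rewrite mulr0.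
by rewrite /sym_signs xy ltnNge (ltnW xy) /=; ring.
Qed.

Lemma tri_coef_sqr a u v :
  \sum_t tri_coef a u v t ^+ 2 <=
  2 * ((\sum_w a w ^+ 2) * (\sum_x u x ^+ 2) * (\sum_y v y ^+ 2)).
Proof.
have E : (\sum_w a w ^+ 2) * (\sum_x u x ^+ 2) * (\sum_y v y ^+ 2) =
    \sum_w \sum_x \sum_y a w ^+ 2 * (u x ^+ 2 * v y ^+ 2).
  rewrite -mulrA mulr_suml; apply: eq_bigr => w _.
  rewrite mulr_suml mulr_sumr; apply: eq_bigr => x _.
  by rewrite !mulr_sumr.
rewrite (eq_bigr (fun t : 'I_L * 'I_K * 'I_K =>
  (fun w x y => tri_coef a u v (w, x, y) ^+ 2) t.1.1 t.1.2 t.2));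
  last by case=> [[w x] y] _.
rewrite (sum_triple (fun w x y => tri_coef a u v (w, x, y) ^+ 2)) E mulr_sumr; apply:
  ler_sum => w _.
pose G x y := if x == y then 0 else a w ^+ 2 * (u x ^+ 2 * v y ^+ 2).
apply: (@le_trans _ _ (2 * \sum_x \sum_y G x y)); last first.
  rewrite ler_pM2l//; apply: ler_sum => x _; apply: ler_sum => y _.
  rewrite /G; case: ifP => _; last exact: lexx.
  by apply: mulr_ge0; [exact: sqr_ge0|apply: mulr_ge0; exact: sqr_ge0].
rewrite (sum_sym (F := G)); last by move=> x; rewrite /G eqxx.
rewrite mulr_sumr; apply: ler_sum => x _; rewrite mulr_sumr; apply: ler_sum => y _.
rewrite /tri_coef /= /G; case: ifP => xy; last by rewrite expr0n mulr0.
have -> : (x == y) = false by apply/negP => /eqP E'; rewrite E' ltnn in xy.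
rewrite eq_sym; have -> : (x == y) = false by apply/negP => /eqP E'; rewrite E' ltnn
  in xy.
rewrite -subr_ge0.
have -> : 2 * (a w ^+ 2 * (u x ^+ 2 * v y ^+ 2) + a w ^+ 2 * (u y ^+ 2 * v x ^+ 2)) -
    (a w * (u x * v y + u y * v x)) ^+ 2 = (a w * (u x * v y - u y * v x)) ^+ 2 by ring.
exact: sqr_ge0.
Qed.

Definition gram (s : 'I_L -> 'I_K -> 'I_K -> R) w w' := \sum_x \sum_y s w x y * s w'
  x y.

(** Products of signs at distinct pairs p, q are uncorrelated: flipping the single sign at (w, p) is
    an involution of the patterns that reverses [f tau p] and fixes [f tau q]. Only the terms p = q
    survive, at most K^2 of them; the factor 4 comes from counting both triangles of the matrix. *)
Lemma gram_second_moment w w' : w != w' ->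
  \sum_tau gram (sym_signs tau) w w' ^+ 2 <=
  #|{ffun 'I_L * 'I_K * 'I_K -> bool}|%:R * (4 * K%:R ^+ 2).
Proof.
move=> ww'.
pose P := [pred p : 'I_K * 'I_K | (p.1 < p.2)%N].
pose f tau (p : 'I_K * 'I_K) := sg R (tau (w, p.1, p.2)) * sg R (tau (w', p.1, p.2)).
have gE tau : gram (sym_signs tau) w w' = 2 * \sum_(p | P p) f tau p.
  rewrite /gram sum_sym; last by move=> x; rewrite /sym_signs ltnn mulr0.
  rewrite pair_bigA /= [in RHS]big_mkcond mulr_sumr /=; apply: eq_bigr => -[x y] _ /=.
  rewrite /sym_signs; case: ifP => xy; last by rewrite mulr0.
  have -> : (y < x)%N = false by rewrite ltnNge (ltnW xy).
  by rewrite xy /f /=; ring.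
under eq_bigr do rewrite gE exprMn [X in _ * X]expr2 mulr_suml.
rewrite -mulr_sumr exchange_big /= mulrCA.
have -> : 2 ^+ 2 = 4 :> R by ring.
rewrite ler_pM2l//.
have cross (p q : 'I_K * 'I_K) : p != q -> \sum_tau f tau p * f tau q = 0.
  move=> pq; set t0 := (w, p.1, p.2).
  pose flip tau := [ffun t => if t == t0 then ~~ tau t else tau t].
  have flipK : involutive flip.
    by move=> tau; apply/ffunP => t; rewrite !ffunE; case: eqP => // _; rewrite negbK.
  have : \sum_tau f tau p * f tau q = - \sum_tau f tau p * f tau q.
    rewrite {1}(reindex_inj (inv_inj flipK)) /= -sumrN.
    apply: eq_bigr => tau _; rewrite /f !ffunE eqxx sgN.
    have -> : ((w', p.1, p.2) == t0) = false.
      by rewrite /t0 !xpair_eqE eq_sym (negbTE ww').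
    have -> : ((w, q.1, q.2) == t0) = false.
      apply: contraNF pq; rewrite /t0 !xpair_eqE eqxx /= => /andP[/eqP h1 /eqP h2].
      by rewrite [p]surjective_pairing [q]surjective_pairing h1 h2.
    have -> : ((w', q.1, q.2) == t0) = false.
      by rewrite /t0 !xpair_eqE eq_sym (negbTE ww').
    by ring.
  by move=> h; lra.
rewrite (eq_bigr (fun p => #|{ffun 'I_L * 'I_K * 'I_K -> bool}|%:R)); last first.
  move=> p Pp.
  rewrite (eq_bigr (fun tau => \sum_(q | P q) f tau p * f tau q)); last first.
    by move=> tau _; rewrite mulr_sumr.
  rewrite exchange_big /= (bigD1 p)//= [X in _ + X]big1 ?addr0; last first.
    by move=> q /andP[_ qp]; rewrite cross// eq_sym.
  rewrite (eq_bigr (fun=> 1)) ?sumr_const ?cardE// => tau _.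
  by rewrite /f mulrACA !sg_sqr mulr1.
rewrite sumr_const -[leLHS]mulr_natr ler_wpM2l ?ler0n// -natrX ler_nat.
by apply: leq_trans (max_card _) _; rewrite card_prod card_ord expnS expn1.
Qed.

Let N := #|{ffun 'I_L * 'I_K * 'I_K -> bool}|.

Let grid n := {ffun 'I_n -> 'I_((2 * n) + (2 * n).+1)}.
Let gn n (z : grid n) := \sum_i gridv R (z i) ^+ 2.

Definition tri_grid s (z1 : grid L) (z2 z3 : grid K) :=
  tri s (fun i => gridv R (z1 i)) (fun i => gridv R (z2 i)) (fun i => gridv R (z3 i)).

(** The exponential of the form divided by its moment bound, where 4 = 2 * 2 collects the constants
    of [signs_mgf] and [tri_coef_sqr], then damped by the grid weights. Its mean over the signs is
    thus at most the weight of the grid point. *)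
Definition grid_term lam tau z1 z2 z3 :=
  expR (- gn z1) * expR (- gn z2) * expR (- gn z3) *
  expR (lam * tri_grid (sym_signs tau) z1 z2 z3 - 4 * lam ^+ 2 * (gn z1 * gn z2 * gn
    z3)).

Lemma grid_sum_mean (lam : R) :
  \sum_tau \sum_z1 \sum_z2 \sum_z3 grid_term lam tau z1 z2 z3
  <= N%:R * expR (2 * L%:R + 4 * K%:R).
Proof.
have E : expR (2 * L%:R + 4 * K%:R) = expR (2 * L%:R) * (expR (2 * K%:R) * expR (2 *
  K%:R)) :> R.
  by rewrite -!expRD; congr expR; ring.
rewrite E exchange_big /=.
apply: (@le_trans _ _ (\sum_z1 \sum_z2 \sum_z3 N%:R * (expR (- gn z1) * (expR (- gn
  z2) * expR (- gn z3))))).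
  apply: ler_sum => z1 _; rewrite exchange_big /=; apply: ler_sum => z2 _.
  rewrite exchange_big /=; apply: ler_sum => z3 _.
  rewrite /grid_term -mulr_sumr -!mulrA [leRHS]mulrC -!mulrA.
  do 3 (rewrite ler_wpM2l ?expR_ge0//).
  under eq_bigr do rewrite expRD.
  rewrite -mulr_suml expRN ler_pdivrMr ?expR_gt0//.
  rewrite (eq_bigr (fun tau => expR (\sum_t sg R (tau t) * (lam * tri_coef
     (fun i => gridv R (z1 i)) (fun i => gridv R (z2 i)) (fun i => gridv R (z3 i))
       t)))); last first.
    by move=> tau _; rewrite /tri_grid tri_signs mulr_sumr; congr expR; apply:
      eq_bigr => t _; ring.
  apply: le_trans (signs_mgf _) _; rewrite ler_wpM2l ?ler0n// ler_expR.
  under eq_bigr do rewrite exprMn.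
  have := tri_coef_sqr (fun i => gridv R (z1 i)) (fun i => gridv R (z2 i)) (fun i =>
    gridv R (z3 i)).
  rewrite -mulr_sumr -/(gn z1) -/(gn z2) -/(gn z3) => h.
  have := ler_wpM2l (sqr_ge0 lam) h; lra.
rewrite (eq_bigr (fun z1 : grid L => N%:R * (expR (- gn z1) * ((\sum_(z2 : grid K)
  expR (- gn z2)) * (\sum_(z3 : grid K) expR (- gn z3)))))); last first.
  move=> z1 _; rewrite mulr_suml !mulr_sumr; apply: eq_bigr => z2 _.
  by rewrite !mulr_sumr.
rewrite -mulr_sumr -mulr_suml ler_wpM2l ?ler0n//.
have S0 n : 0 <= \sum_(z : grid n) expR (- gn z) by apply: sumr_ge0 => ? _; exact:
  expR_ge0.
apply: ler_pM; rewrite ?mulr_ge0 ?S0 ?grid_weights//.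
by apply: ler_pM; rewrite ?S0 ?grid_weights.
Qed.

Hypothesis K0 : (0 < K)%N.
Hypothesis L0 : (0 < L)%N.
Hypothesis LK : (L <= K)%N.
Hypothesis LLK : (128 * L.-1 <= K)%N.

(* Both functionals of tau are nonnegative, so some tau has each of them at most
   twice its mean. *)
Lemma good_signs : exists tau,
  (forall z1 z2 z3, gn z1 <= 10 * L%:R -> gn z2 <= 10 * K%:R -> gn z3 <= 10 * K%:R ->
     tri_grid (sym_signs tau) z1 z2 z3 <= 4 * 32 * 32 * K%:R * Num.sqrt (L%:R *
       K%:R)) /\
  \sum_w \sum_(w' | w' != w) gram (sym_signs tau) w w' ^+ 2 <= K%:R ^+ 4 / 32 / 32.
Proof.
have N0 : 0 < N%:R :> R by rewrite ltr0n /N card_ffun card_bool expn_gt0.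
have Kp : 0 < K%:R :> R by rewrite ltr0n.
have Lp : 0 < L%:R :> R by rewrite ltr0n.
have LKr : L%:R <= K%:R :> R by rewrite ler_nat.
set r := Num.sqrt (L%:R * K%:R : R).
have rp : 0 < r by rewrite sqrtr_gt0 mulr_gt0.
have rE : r ^+ 2 = L%:R * K%:R by rewrite sqr_sqrtr// mulr_ge0 ?ler0n.
(* With lam^2 = 1 / (L K) the correction 4 lam^2 (10 L) (10 K)^2 equals 4000 K, of the same order as
   the logarithm of the total grid weight. *)
pose lam : R := r^-1.
pose F1 tau := \sum_z1 \sum_z2 \sum_z3 grid_term lam tau z1 z2 z3.
pose A1 : R := expR (2 * L%:R + 4 * K%:R).
pose F2 tau := \sum_w \sum_(w' | w' != w) gram (sym_signs tau) w w' ^+ 2.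
(* The mean is at most 4 K^2 L (L - 1) <= 8 K^2 (L - 1)^2 <= 8 K^4 / 128^2, which is this value; the
   number 128 in [LLK] is used here. Twice it is (K^2 / 32)^2. *)
pose A2 : R := K%:R ^+ 4 / 32 / 64.
have A1p : 0 < A1 by exact: expR_gt0.
have A2p : 0 < A2 by rewrite !divr_gt0 ?exprn_gt0.
have F2m : \sum_tau F2 tau <= N%:R * A2.
  rewrite /F2 exchange_big /=.
  apply: (@le_trans _ _ (\sum_(w < L) \sum_(w' | w' != w) N%:R * (4 * K%:R ^+ 2))).
    apply: ler_sum => w _; rewrite exchange_big /=; apply: ler_sum => w' ww'.
    by apply: gram_second_moment; rewrite eq_sym.
  rewrite (eq_bigr (fun=> (N%:R * (4 * K%:R ^+ 2)) *+ L.-1)); last first.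
    by move=> w _; rewrite sumr_const; congr (_ *+ _); rewrite cardC1 card_ord.
  rewrite sumr_const card_ord -mulrnA -[_ *+ (_ * _)]mulr_natr -mulrA ler_pM2l//.
  have h : 128 * L.-1%:R <= K%:R :> R by rewrite -natrM ler_nat.
  have h' : L.-1%:R * L%:R <= 2 * L.-1%:R ^+ 2 :> R.
    rewrite -natrM -natrX -natrM ler_nat; nia.
  rewrite /A2 natrM.
  have -> : K%:R ^+ 4 = K%:R ^+ 2 * K%:R ^+ 2 :> R by ring.
  have K2 : 0 <= K%:R ^+ 2 :> R by exact: sqr_ge0.
  have l0 : 0 <= L.-1%:R :> R by rewrite ler0n.
  have h2 : 128 * 128 * L.-1%:R ^+ 2 <= K%:R ^+ 2 :> R by nra.
  have := ler_wpM2l K2 h2; have := ler_wpM2l K2 h'; lra.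
have F20 tau : 0 <= F2 tau.
  by apply: sumr_ge0 => ? _; apply: sumr_ge0 => ? _; exact: sqr_ge0.
have g0 tau z1 z2 z3 : 0 <= grid_term lam tau z1 z2 z3 by rewrite !mulr_ge0 ?expR_ge0.
have F10 tau : 0 <= F1 tau.
  by do 3 (apply: sumr_ge0 => ? _).
have [tau] : exists tau, F1 tau / A1 + F2 tau / A2 <= 2.
  apply: contrapT => /forallNP no.
  have : \sum_(tau : {ffun 'I_L * 'I_K * 'I_K -> bool}) (2 : R) < \sum_tau (F1 tau /
    A1 + F2 tau / A2).
    apply: ltr_sum; last by move=> tau _; rewrite ltNge; apply/negP.
    by apply/hasP; exists [ffun=> true]; rewrite ?mem_index_enum.
  rewrite !big_split /= sumr_const -/N.
  have h1 : \sum_tau (F1 tau / A1) <= N%:R by rewrite -mulr_suml ler_pdivrMr//;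
    exact: grid_sum_mean.
  have h2 : \sum_tau (F2 tau / A2) <= N%:R by rewrite -mulr_suml ler_pdivrMr.
  by lra.
move=> ht; exists tau.
have h1 : F1 tau <= 2 * A1.
  rewrite -ler_pdivrMr//; have : 0 <= F2 tau / A2 by rewrite divr_ge0// ltW.
  by lra.
have h2 : F2 tau <= 2 * A2.
  rewrite -ler_pdivrMr//; have : 0 <= F1 tau / A1 by rewrite divr_ge0// ltW.
  by lra.
split; last by apply: le_trans h2 _; rewrite /A2; lra.
move=> z1 z2 z3 n1 n2 n3.
have : grid_term lam tau z1 z2 z3 <= expR (1 + (2 * L%:R + 4 * K%:R)).
  rewrite expRD; apply: le_trans (_ : 2 * A1 <= _); last first.
    by rewrite ler_pM2r//; have := expR_ge1Dx (1 : R); lra.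
  apply: le_trans h1; rewrite /F1 (bigD1 z1)//= (bigD1 z2)//= (bigD1 z3)//= -!addrA.
  by rewrite lerDl !addr_ge0//; repeat (apply: sumr_ge0 => ? _).
rewrite /grid_term -!expRD ler_expR.
set t := tri_grid _ _ _ _.
have n0 n (z : grid n) : 0 <= gn z by apply: sumr_ge0 => ? _; exact: sqr_ge0.
have nn : gn z1 * gn z2 * gn z3 <= 10 * L%:R * (10 * K%:R) * (10 * K%:R).
  by rewrite !ler_pM ?mulr_ge0.
have lE : lam ^+ 2 * (10 * L%:R * (10 * K%:R) * (10 * K%:R)) = 10 * 10 * 10 * K%:R.
  by rewrite /lam exprVn rE; field; lra.
have := ler_wpM2l (sqr_ge0 lam) nn; rewrite lE => nn'.
have K1 : 1 <= K%:R :> R by rewrite ler1n.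
(* The exponents add up to at most 1 + 12 L + 24 K + 4000 K <= 4037 K, below 4 * 32 * 32 K = 4096
   K. *)
move=> h; have : lam * t <= 4 * 32 * 32 * K%:R by lra.
by rewrite /lam mulrC ler_pdivrMr// => h'.
Qed.

Lemma tri_linearl s a u v : tri s a u v = \sum_w (\sum_x \sum_y u x * v y * s w x y)
  * a w.
Proof.
apply: eq_bigr => w _; rewrite mulr_suml; apply: eq_bigr => x _.
by rewrite mulr_suml; apply: eq_bigr => y _; ring.
Qed.

Lemma tri_linearm s a u v : tri s a u v = \sum_x (\sum_w \sum_y a w * v y * s w x y)
  * u x.
Proof.
rewrite /tri exchange_big; apply: eq_bigr => x _; rewrite mulr_suml; apply: eq_bigr
  => w _.
by rewrite mulr_suml; apply: eq_bigr => y _; ring.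
Qed.

Lemma tri_linearr s a u v : tri s a u v = \sum_y (\sum_w \sum_x a w * u x * s w x y)
  * v y.
Proof.
rewrite /tri; under eq_bigr do rewrite exchange_big.
rewrite exchange_big; apply: eq_bigr => y _; rewrite mulr_suml; apply: eq_bigr => w _.
by rewrite mulr_suml; apply: eq_bigr => x _; ring.
Qed.

(** The form is linear in each slot, so [grid_norm] frees one slot at a time from grid vectors to
    arbitrary ones. It takes a grid bound m * 2 sqrt n to a norm bound 2 m, so each slot divides the
    bound by the square root of its dimension: 4096 K sqrt (L K) becomes 4096 sqrt K. *)
Lemma tri_norm s :
  (forall z1 z2 z3, gn z1 <= 10 * L%:R -> gn z2 <= 10 * K%:R -> gn z3 <= 10 * K%:R ->
     tri_grid s z1 z2 z3 <= 4 * 32 * 32 * K%:R * Num.sqrt (L%:R * K%:R)) ->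
  forall a u v, tri s a u v ^+ 2 <=
    (4 * 32 * 32) ^+ 2 * K%:R * ((\sum_w a w ^+ 2) * (\sum_x u x ^+ 2) * (\sum_y v y
      ^+ 2)).
Proof.
move=> H.
have Kp : 0 < K%:R :> R by rewrite ltr0n.
have Lp : 0 < L%:R :> R by rewrite ltr0n.
set k := Num.sqrt (K%:R : R); have kp : 0 < k by rewrite sqrtr_gt0.
have kE : k ^+ 2 = K%:R by rewrite sqr_sqrtr ?ltW.
have sq (x c : R) : 0 <= c -> x ^+ 2 <= c -> x <= Num.sqrt c.
  by move=> c0 h; apply: le_trans (ler_norm _) _; rewrite -sqrtr_sqr ler_wsqrtr.
pose mA : R := 4 * 32 * 32 * K%:R * k / 2.
have sA (z2 z3 : grid K) a : gn z2 <= 10 * K%:R -> gn z3 <= 10 * K%:R ->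
    tri s a (fun i => gridv R (z2 i)) (fun i => gridv R (z3 i)) <= 2 * mA * Num.sqrt
      (\sum_w a w ^+ 2).
  move=> n2 n3; set a2 := \sum_w _.
  have a20 : 0 <= a2 by apply: sumr_ge0 => ? _; exact: sqr_ge0.
  have mA0 : 0 <= 2 * mA by rewrite !mulr_ge0// ltW.
  rewrite -(ger0_norm mA0) -sqrtr_sqr -sqrtrM ?sqr_ge0//; apply: sq; first by rewrite
    mulr_ge0 ?sqr_ge0.
  rewrite tri_linearl; apply: le_trans (cauchy_schwarz_sum _ _) _.
  rewrite ler_wpM2r//; have -> : (2 * mA) ^+ 2 = 4 * mA ^+ 2 by ring.
  apply: grid_norm => z1 n1; have := H z1 z2 z3 n1 n2 n3.
  rewrite /tri_grid tri_linearl sqrtrM ?ler0n// -/k => h.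
  by apply: le_trans h _; rewrite /mA; lra.
have sB (z3 : grid K) a u : gn z3 <= 10 * K%:R ->
    tri s a u (fun i => gridv R (z3 i)) <= 2 * (mA / k) * Num.sqrt (\sum_w a w ^+ 2)
      * Num.sqrt (\sum_x u x ^+ 2).
  move=> n3; set a2 := \sum_w _; set u2 := \sum_x _.
  have a20 : 0 <= a2 by apply: sumr_ge0 => ? _; exact: sqr_ge0.
  have u20 : 0 <= u2 by apply: sumr_ge0 => ? _; exact: sqr_ge0.
  have c0 : 0 <= 2 * (mA / k) * Num.sqrt a2 by rewrite !mulr_ge0 ?sqrtr_ge0 ?invr_ge0
    ?ltW.
  rewrite -(ger0_norm c0) -sqrtr_sqr -sqrtrM ?sqr_ge0//; apply: sq; first by rewrite
    mulr_ge0 ?sqr_ge0.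
  rewrite tri_linearm; apply: le_trans (cauchy_schwarz_sum _ _) _.
  rewrite ler_wpM2r//; have -> : (2 * (mA / k) * Num.sqrt a2) ^+ 2 = 4 * (mA / k *
    Num.sqrt a2) ^+ 2 by ring.
  apply: grid_norm => z2 n2; have := sA z2 z3 a n2 n3.
  rewrite tri_linearm -/k -/a2 => h; apply: le_trans h _.
  by rewrite le_eqVlt; apply/orP; left; apply/eqP; field; lra.
move=> a u v; set a2 := \sum_w a w ^+ 2; set u2 := \sum_x u x ^+ 2.
have a20 : 0 <= a2 by apply: sumr_ge0 => ? _; exact: sqr_ge0.
have u20 : 0 <= u2 by apply: sumr_ge0 => ? _; exact: sqr_ge0.
rewrite tri_linearr; apply: le_trans (cauchy_schwarz_sum _ _) _.
rewrite mulrA ler_wpM2r//; first by apply: sumr_ge0 => ? _; exact: sqr_ge0.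
have -> : (4 * 32 * 32) ^+ 2 * K%:R * (a2 * u2) = 4 * (mA / k ^+ 2 * Num.sqrt a2 *
  Num.sqrt u2) ^+ 2.
  by rewrite !exprMn !sqr_sqrtr// /mA -kE; field; lra.
apply: grid_norm => z3 n3; have := sB z3 a u n3.
rewrite tri_linearr -/k -/a2 -/u2 => h; apply: le_trans h _.
by rewrite le_eqVlt; apply/orP; left; apply/eqP; field; lra.
Qed.

(* The Gram matrix of the sign matrices is K(K-1) times the identity up to a
   perturbation that is small in Frobenius norm. *)
Lemma tri_hs_lower tau : (2 <= K)%N ->
  \sum_w \sum_(w' | w' != w) gram (sym_signs tau) w w' ^+ 2 <= K%:R ^+ 4 / 32 / 32 ->
  forall a, K%:R ^+ 2 / 4 * (\sum_w a w ^+ 2) <=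
    \sum_x \sum_y (\sum_w a w * sym_signs tau w x y) ^+ 2.
Proof.
move=> K2 H a; set a2 := \sum_w a w ^+ 2; set s := sym_signs tau.
have a20 : 0 <= a2 by apply: sumr_ge0 => ? _; exact: sqr_ge0.
have K2r : 2 <= K%:R :> R by rewrite ler_nat.
have E : \sum_x \sum_y (\sum_w a w * s w x y) ^+ 2 =
    \sum_w \sum_w' a w * a w' * gram s w w'.
  under eq_bigr => x _ do under eq_bigr => y _ do rewrite expr2 mulr_suml.
  under eq_bigr => x _ do rewrite exchange_big.
  rewrite exchange_big; apply: eq_bigr => w _ /=.
  under eq_bigr => x _ do under eq_bigr => y _ do rewrite mulr_sumr.
  under eq_bigr => x _ do rewrite exchange_big.
  rewrite exchange_big; apply: eq_bigr => w' _ /=.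
  rewrite /gram mulr_sumr; apply: eq_bigr => x _; rewrite mulr_sumr.
  by apply: eq_bigr => y _; ring.
have gd w : gram s w w = K%:R * (K%:R - 1).
  rewrite /gram /s (eq_bigr (fun=> K%:R - 1)); first by rewrite sumr_const card_ord
    mulr_natl.
  move=> x _; rewrite (bigD1 x)//= /sym_signs ltnn mulr0 add0r.
  rewrite (eq_bigr (fun=> 1)).
    by rewrite sumr_const cardC1 card_ord -subn1 natrB// ltnW.
  move=> y yx; case: ltngtP => [_|_|/val_inj xy]; rewrite ?sg_sqr//.
  by rewrite xy eqxx in yx.
rewrite E (eq_bigr (fun w => a w ^+ 2 * (K%:R * (K%:R - 1)) +
   \sum_(w' | w' != w) a w * a w' * gram s w w')); last first.
  by move=> w _; rewrite (bigD1 w)//= gd expr2.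
rewrite big_split /= -mulr_suml -/a2.
set Z := \sum_w \sum_(w' | w' != w) _.
have Z2 : Z ^+ 2 <= (a2 * (K%:R ^+ 2 / 32)) ^+ 2.
  pose A (p : 'I_L * 'I_L) := a p.1 * a p.2.
  pose G (p : 'I_L * 'I_L) := if p.2 != p.1 then gram s p.1 p.2 else 0.
  have -> : Z = \sum_p A p * G p.
    rewrite -(pair_bigA _ (fun w w' => A (w, w') * G (w, w'))) /=.
    apply: eq_bigr => w _; rewrite big_mkcond; apply: eq_bigr => w' _.
    by rewrite /A /G /=; case: ifP; rewrite ?mulr0.
  apply: le_trans (cauchy_schwarz_sum _ _) _; rewrite exprMn; apply: ler_pM.
  - by apply: sumr_ge0 => ? _; exact: sqr_ge0.
  - by apply: sumr_ge0 => ? _; exact: sqr_ge0.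
  - rewrite -(pair_bigA _ (fun w w' => A (w, w') ^+ 2)) /= expr2 mulr_suml.
    apply: ler_sum => w _; rewrite mulr_sumr; apply: ler_sum => w' _.
    by rewrite exprMn.
  - rewrite -(pair_bigA _ (fun w w' => G (w, w') ^+ 2)) /=.
    have -> : (K%:R ^+ 2 / 32) ^+ 2 = K%:R ^+ 4 / 32 / 32 :> R by field.
    apply: le_trans H; apply: ler_sum => w _; rewrite [leRHS]big_mkcond.
    by apply: ler_sum => w' _; rewrite /G /=; case: ifP; rewrite ?expr0n.
have : - (a2 * (K%:R ^+ 2 / 32)) <= Z.
  rewrite -ler_sqrt in Z2; last by rewrite sqr_ge0.
  rewrite !sqrtr_sqr [leRHS]ger0_norm in Z2; last by rewrite mulr_ge0 ?divr_ge0
    ?sqr_ge0.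
  by rewrite ler_norml in Z2; case/andP: Z2.
move=> hZ.
have h : 0 <= K%:R * (K%:R - 1) - K%:R ^+ 2 / 4 - K%:R ^+ 2 / 32 :> R by nra.
by have := mulr_ge0 a20 h; lra.
Qed.

End RandomTensor.

(** * A local basis with a nearly Euclidean part *)

Section ComplexMatrices.
Local Open Scope complex_scope.
Local Open Scope sesquilinear_scope.
Variable R : realType.
Local Notation C := R[i].

Lemma cabs_sqr (z : C) : cabs z ^+ 2 = complex.Re z ^+ 2 + complex.Im z ^+ 2.
Proof. by rewrite /cabs normc_def /= sqr_sqrtr// addr_ge0 ?sqr_ge0. Qed.

Lemma cabs_ge0 (z : C) : 0 <= cabs z.
Proof. by rewrite /cabs normc_def /= sqrtr_ge0. Qed.

Lemma cabsM_sqr (z w : C) : cabs (z * w) ^+ 2 = cabs z ^+ 2 * cabs w ^+ 2.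
Proof. by rewrite !cabs_sqr; case: z => a b; case: w => c d /=; ring. Qed.

Lemma cabs_sqr_real (x : R) : cabs x%:C ^+ 2 = x ^+ 2.
Proof. by rewrite cabs_sqr /= expr0n addr0. Qed.

Lemma mulC_conj (z : C) : z * z^*%R = (cabs z ^+ 2)%:C.
Proof. by rewrite -normCK cabs_sqr add_Re2_Im2. Qed.

Definition nsq m n (A : 'M[C]_(m, n)) : R := \sum_i \sum_j cabs (A i j) ^+ 2.

Lemma nsq_ge0 m n (A : 'M[C]_(m, n)) : 0 <= nsq A.
Proof. by apply: sumr_ge0 => ? _; apply: sumr_ge0 => ? _; exact: sqr_ge0. Qed.

Lemma mxtrace_mul_adj m n (A B : 'M[C]_(m, n)) :
  \tr (A *m B^t*) = \sum_i \sum_j A i j * (B i j)^*%R.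
Proof.
by apply: eq_bigr => i _; rewrite mxE; apply: eq_bigr => j _; rewrite !mxE.
Qed.

Lemma nsqE m n (A : 'M[C]_(m, n)) : (nsq A)%:C = \tr (A *m A^t*).
Proof.
rewrite mxtrace_mul_adj /nsq raddf_sum; apply: eq_bigr => i _ /=.
by rewrite raddf_sum; apply: eq_bigr => j _ /=; rewrite mulC_conj.
Qed.

Lemma nsqE_adj m n (A : 'M[C]_(m, n)) : (nsq A)%:C = \tr (A^t* *m A).
Proof. by rewrite mxtrace_mulC nsqE. Qed.

Lemma adjmxM m n p (A : 'M[C]_(m, n)) (B : 'M[C]_(n, p)) :
  (A *m B)^t* = B^t* *m A^t*.
Proof. by rewrite trmx_mul map_mxM. Qed.

(** The diagonalization is part of the statement because the later argument needs the
    eigenprojections and not only a norm. As everywhere below, the bound is on squares. *)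
Definition spec_bound K (H : 'M[C]_K) (m : R) : Prop :=
  exists (P : 'M[C]_K) (lam : 'I_K -> R),
    [/\ P \is unitarymx, H = P^t* *m diag_mx (\row_k (lam k)%:C) *m P
      & forall k, lam k ^+ 2 <= m].

Definition real_comb L K (s : 'I_L -> 'I_K -> 'I_K -> R) (b : 'I_L -> R) : 'M[C]_K :=
  \matrix_(x, y) (\sum_w b w * s w x y)%:C.

(** A unit eigenvector v may be complex, but for a real symmetric matrix its quadratic form is the
    sum of the forms at Re v and Im v, so the bound on real vectors controls every eigenvalue. *)
Lemma spec_bound_real L K (s : 'I_L -> 'I_K -> 'I_K -> R) (M2 : R) :
  (forall w x y, s w x y = s w y x) -> 0 <= M2 ->
  (forall a u v, tri s a u v ^+ 2 <=
     M2 * ((\sum_w a w ^+ 2) * (\sum_x u x ^+ 2) * (\sum_y v y ^+ 2))) ->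
  forall b, spec_bound (real_comb s b) (M2 * \sum_w b w ^+ 2).
Proof.
move=> sym M20 H b; set Hm := real_comb s b; set b2 := \sum_w _.
have b20 : 0 <= b2 by apply: sumr_ge0 => ? _; exact: sqr_ge0.
have Hherm : Hm \is hermsymmx.
  apply: realsym_hermsym.
    apply/is_hermitianmxP; rewrite expr0 scale1r; apply/matrixP => x y; rewrite !mxE.
    by congr (_%:C); apply: eq_bigr => w _; rewrite sym.
  by apply/mxOverP => x y; rewrite mxE complex_real.
have /orthomx_spectralP HE := hermitian_normalmx Hherm.
have realD := hermitian_spectral_diag_real Hherm.
set P := spectralmx Hm in HE; have Pu : P \is unitarymx := spectral_unitarymx _.
pose lam k := complex.Re (spectral_diag Hm 0 k).
have lamE : spectral_diag Hm = \row_k (lam k)%:C.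
  apply/rowP => k; rewrite mxE /lam.
  by have /complex_realP[x ->] : spectral_diag Hm 0 k \is Num.real by exact/mxOverP.
rewrite invmx_unitary// lamE in HE.
exists P, lam; split => // k.
set v := row k P.
have vv : v *m v^t* = 1%:M.
  apply/matrixP => i j; rewrite !ord1 !mxE eqxx.
  have /unitarymxP/matrixP/(_ k k) := Pu; rewrite !mxE eqxx => hk; rewrite -[RHS]hk.
  by apply: eq_bigr => l _; rewrite !mxE.
have vH : v *m Hm = (lam k)%:C *: v.
  rewrite HE /v -row_mul !mulmxA (unitarymxP Pu) mul1mx row_mul.
  by rewrite row_diag_mx mxE -scalemxAl -rowE.
have nv : nsq v = 1.
  have := nsqE v; rewrite vv mxtrace1 => h.
  by have := congr1 (@complex.Re R) h.
have lamtri : lam k = tri s b (fun x => complex.Re (v 0 x)) (fun x => complex.Re (v 0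
  x))
    + tri s b (fun x => complex.Im (v 0 x)) (fun x => complex.Im (v 0 x)).
  have : \tr (v *m Hm *m v^t*) = (lam k)%:C.
    by rewrite vH -scalemxAl vv mxtraceZ mxtrace1 mulr1.
  rewrite mxtrace_mul_adj big_ord1 => /(congr1 (@complex.Re R)).
  rewrite [X in _ = X -> _]/= => <-.
  rewrite !tri_linearr -big_split raddf_sum; apply: eq_bigr => y _ /=.
  have E (p : 'I_K -> R) : \sum_w \sum_x b w * p x * s w x y = \sum_x p x * (\sum_w b
    w * s w x y).
    rewrite exchange_big; apply: eq_bigr => x _; rewrite mulr_sumr.
    by apply: eq_bigr => w _; ring.
  rewrite !E mxE [in LHS]mulr_suml [in LHS]raddf_sum !mulr_suml -big_split; apply:
    eq_bigr => x _ /=.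
  have -> : Hm x y = (\sum_w b w * s w x y)%:C by rewrite mxE.
  move: (\sum_w b w * s w x y) (v 0 x) (v 0 y) => h [p1 q1] [p2 q2] /=; ring.
have root (t c : R) : 0 <= c -> t ^+ 2 <= c ^+ 2 -> t <= c.
  move=> c0 h; apply: le_trans (ler_norm _) _.
  by rewrite -(ger0_norm c0) -ler_sqr ?nnegrE ?normr_ge0// !real_normK ?num_real.
set r := Num.sqrt (M2 * b2).
have r0 : 0 <= r by exact: sqrtr_ge0.
have rE : r ^+ 2 = M2 * b2 by rewrite sqr_sqrtr ?mulr_ge0.
have tb (u : 'I_K -> R) : `|tri s b u u| <= r * \sum_x u x ^+ 2.
  set u2 := \sum_x _; have u20 : 0 <= u2 by apply: sumr_ge0 => ? _; exact: sqr_ge0.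
  apply: root; first exact: mulr_ge0.
  rewrite real_normK ?num_real//; apply: le_trans (H _ _ _) _.
  by rewrite exprMn rE -/b2 -/u2; lra.
have hl : `|lam k| <= r.
  rewrite lamtri; apply: le_trans (ler_normD _ _) _.
  apply: le_trans (lerD (tb _) (tb _)) _.
  rewrite -mulrDr -big_split /= -[leRHS]mulr1 -nv /nsq big_ord1.
  by under [in leRHS]eq_bigr do rewrite cabs_sqr.
by rewrite -rE -[leLHS]real_normK ?num_real// lerXn2r ?nnegrE.
Qed.

Lemma mxvec_dot_adj m n (A B : 'M[C]_(m, n)) :
  mxvec A *m (mxvec B)^t* = (\tr (A *m B^t*))%:M.
Proof.
apply/matrixP => i j; rewrite !ord1 mxE [RHS]mxE eqxx mulr1n mxtrace_mul_adj
  pair_bigA /=.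
rewrite (reindex _ (curry_mxvec_bij _ _)) /=; apply: eq_bigr => -[x y] _ /=.
by rewrite !mxE !mxvecE.
Qed.

Lemma orthonormal_basis_of (K : nat) (B : 'I_(K ^ 2) -> 'M[C]_K) : (0 < K)%N ->
  (forall mu nu, hs_inner (B mu) (B nu) = (mu == nu)%:R) -> basis_of fullv (codom B).
Proof.
move=> K0 ortho.
have sz : size (codom B) = (K ^ 2)%N by rewrite size_codom card_ord.
have dimf : \dim (fullv : {vspace 'M[C]_K}) = (K ^ 2)%N.
  by rewrite dimvf /dim /= mulnn.
rewrite basisEfree subvf sz dimf leqnn !andbT.
pose T : (K ^ 2).-tuple 'M[C]_K := [tuple B i | i < K ^ 2].
have -> : codom B = T :> seq _ by rewrite codomE /= enumT.
apply/freeP => k hk i.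
have {}hk : \sum_(i < K ^ 2) k i *: B i = 0.
  by rewrite -[RHS]hk; apply: eq_bigr => j _; rewrite -tnth_nth tnth_mktuple.
have : hs_inner (\sum_(i < K ^ 2) k i *: B i) (B i) = k i.
  rewrite /hs_inner mulmx_suml raddf_sum mulr_sumr (bigD1 i)//= big1 ?addr0.
    by rewrite -scalemxAl mxtraceZ mulrCA -/(hs_inner _ _) ortho eqxx mulr1.
  move=> j ji; rewrite -scalemxAl mxtraceZ mulrCA -/(hs_inner _ _) ortho.
  by rewrite (negbTE ji) mulr0.
by rewrite hk /hs_inner mul0mx mxtrace0 mulr0.
Qed.

Lemma adjmxZ m n (a : C) (A : 'M[C]_(m, n)) : (a *: A)^t* = a^*%R *: A^t*.
Proof. by apply/matrixP => i j; rewrite !mxE rmorphM. Qed.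

(** Only the span of the [S w] matters, so Gram-Schmidt may replace the matrices themselves. Trace
    zero is orthogonality to the identity; the remaining basis elements come from an orthonormal
    basis of the orthogonal complement of the vectors chosen so far. *)
Lemma exists_local_basis (K L : nat) (S : 'I_L -> 'M[C]_K) : (0 < K)%N ->
  (forall w, \tr (S w) = 0) ->
  (forall a : 'I_L -> C, \sum_w a w *: S w = 0 -> forall w, a w = 0) ->
  exists (B : 'I_(K ^ 2) -> 'M[C]_K) (idx : 'I_L -> 'I_(K ^ 2)),
    [/\ normalized_local_basis B, injective idx, forall w, idx w <> 0%N :> nat
      & forall al : 'I_L -> C, exists a : 'I_L -> C,
          \sum_w al w *: B (idx w) = \sum_w a w *: S w].
Proof.
move=> K0 trS freeS.
have Kn0 : K%:R != 0 :> C by rewrite pnatr_eq0 -lt0n.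
(* Rescales Frobenius-orthonormal vectors to the inner product with its factor 1 / K. *)
pose k : C := sqrtC K%:R.
have kE : k ^+ 2 = K%:R by rewrite sqrtCK.
have kn0 : k != 0 by rewrite -sqrf_eq0 kE.
have k_ge0 : 0 <= k by rewrite sqrtC_ge0 ler0n.
have kc : k^*%R = k by apply: CrealP; exact: ger0_real.
have kVc : (k^-1)^*%R = k^-1 by rewrite fmorphV /= kc.
pose SM : 'M[C]_(L, K * K) := \matrix_w mxvec (S w).
have rowSM w : row w SM = mxvec (S w) by rewrite rowK.
have combSM (c : 'rV[C]_L) : vec_mx (c *m SM) = \sum_w c 0 w *: S w.
  rewrite mulmx_sum_row raddf_sum; apply: eq_bigr => w _ /=.
  by rewrite linearZ /= rowSM mxvecK.
have SMfree : row_free SM.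
  apply/inj_row_free => c cSM; apply/rowP => w; rewrite mxE.
  by apply: freeS; rewrite -combSM cSM linear0.
pose U0 : 'rV[C]_(K * K) := k^-1 *: mxvec 1%:M.
have U0U0 : U0 *m U0^t* = 1%:M.
  rewrite /U0 adjmxZ kVc -scalemxAl -scalemxAr mxvec_dot_adj.
  rewrite trmx1 map_mx1 mulmx1 mxtrace1 -kE !scale_scalar_mx.
  by congr (_%:M); field.
pose U1 := schmidt SM.
have LKK : (L <= K * K)%N by rewrite -(eqP SMfree) rank_leq_col.
have U1U1 : U1 *m U1^t* = 1%:M by apply/unitarymxP; exact: schmidt_unitarymx.
have U1SM : (U1 <= SM)%MS by rewrite (eqmx_schmidt_free SMfree).
have U1U0 : U1 *m U0^t* = 0.
  have /submxP[D ->] := U1SM; rewrite -mulmxA.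
  suff -> : SM *m U0^t* = 0 by rewrite mulmx0.
  apply/row_matrixP => w; rewrite row_mul rowSM row0 /U0 adjmxZ -scalemxAr.
  by rewrite mxvec_dot_adj trmx1 map_mx1 mulmx1 trS raddf0 scaler0.
have U0U1 : U0 *m U1^t* = 0.
  by rewrite -[LHS]trmxCK adjmxM trmxCK U1U0 trmx0 map_mx0.
pose V : 'M[C]_(1 + L, K * K) := col_mx U0 U1.
have VV : V *m V^t* = 1%:M.
  rewrite /V tr_col_mx map_row_mx mul_col_row U0U0 U1U1 U0U1 U1U0.
  by rewrite -scalar_mx_block.
have rkV : \rank V = (1 + L)%N by apply: mxrank_unitary; exact/unitarymxP.
have VKK : (1 + L <= K * K)%N by rewrite -rkV rank_leq_col.
pose Q := kermx (V^t*); pose r := \rank Q.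
have rE : r = (K * K - (1 + L))%N by rewrite /r mxrank_ker mxrank_map mxrank_tr rkV.
pose U2 : 'M[C]_(r, K * K) := schmidt (row_base Q).
have rKK : (r <= K * K)%N by rewrite rE leq_subr.
have U2U2 : U2 *m U2^t* = 1%:M by apply/unitarymxP; exact: schmidt_unitarymx.
have U2V : U2 *m V^t* = 0.
  by apply/sub_kermxP; rewrite (eqmx_schmidt_free (row_base_free Q)) eq_row_base.
have VU2 : V *m U2^t* = 0.
  by rewrite -[LHS]trmxCK adjmxM trmxCK U2V trmx0 map_mx0.
pose W : 'M[C]_((1 + L) + r, K * K) := col_mx V U2.
have WW : W *m W^t* = 1%:M.
  rewrite /W tr_col_mx map_row_mx mul_col_row VV U2U2 VU2 U2V.
  by rewrite -scalar_mx_block.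
have e : (K ^ 2 = (1 + L) + r)%N by rewrite rE subnKC// expnS expn1.
pose B mu := k *: vec_mx (row (cast_ord e mu) W).
pose idx w := cast_ord (esym e) (lshift r (rshift 1 w)).
have Bidx w : B (idx w) = k *: vec_mx (row w U1).
  by rewrite /B /idx cast_ordKV /W rowKu /V rowKd.
have ortho mu nu : hs_inner (B mu) (B nu) = (mu == nu)%:R.
  rewrite /hs_inner /B adjmxZ -scalemxAl -scalemxAr !mxtraceZ kc.
  have -> (A D : 'rV[C]_(K * K)) : \tr (vec_mx A *m (vec_mx D)^t*) = (A *m D^t*) 0 0.
    by rewrite -{2}[A]vec_mxK -{2}[D]vec_mxK mxvec_dot_adj mxE eqxx mulr1n.
  have -> : (row (cast_ord e mu) W *m (row (cast_ord e nu) W)^t*) 0 0 = (W *m W^t*)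
    (cast_ord e mu) (cast_ord e nu).
    by rewrite !mxE; apply: eq_bigr => j _; rewrite !mxE.
  rewrite WW mxE (inj_eq (@cast_ord_inj _ _ _)) mulrA mulrA -expr2 -kE.
  by rewrite mulVf ?mul1r// expf_neq0.
exists B, idx; split.
- split; [|exact: ortho|exact: orthonormal_basis_of].
  move=> mu mu0; rewrite /B.
  have -> : cast_ord e mu = lshift r (lshift L ord0) by apply: val_inj.
  by rewrite /W rowKu /V rowKu /U0 row_id linearZ /= mxvecK scalerA divff// scale1r.
- by move=> w w' /cast_ord_inj /lshift_inj /rshift_inj.
- by move=> w.
move=> al.
have /submxP[D U1E] := U1SM.
exists (fun w => k * ((\row_w al w) *m D) 0 w).
rewrite (eq_bigr (fun w => k *: (vec_mx (al w *: row w U1)))); last first.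
  by move=> w _; rewrite Bidx [vec_mx (_ *: _)]linearZ /= !scalerA [al w * k]mulrC.
rewrite -scaler_sumr -raddf_sum /=.
have -> : \sum_w al w *: row w U1 = (\row_w al w) *m U1.
  by rewrite mulmx_sum_row; apply: eq_bigr => w _; rewrite mxE.
rewrite U1E mulmxA combSM scaler_sumr; apply: eq_bigr => w _.
by rewrite scalerA.
Qed.

Lemma spec_bound_le K (H : 'M[C]_K) (m m' : R) : m <= m' -> spec_bound H m ->
  spec_bound H m'.
Proof.
move=> mm' [P [lam [Pu HE hl]]]; exists P, lam; split => // k.
exact: le_trans (hl k) mm'.
Qed.

Lemma nsq_orthonormal_comb K L (B : 'I_(K ^ 2) -> 'M[C]_K) (idx : 'I_L -> 'I_(K ^ 2)) :
  (0 < K)%N -> (forall mu nu, hs_inner (B mu) (B nu) = (mu == nu)%:R) -> injective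
    idx ->
  forall al : 'I_L -> C, nsq (\sum_w al w *: B (idx w)) = K%:R * \sum_w cabs (al w)
    ^+ 2.
Proof.
move=> K0 ortho inj al; apply: (@complexI R).
have Kn0 : K%:R != 0 :> C by rewrite pnatr_eq0 -lt0n.
have tr mu nu : \tr (B mu *m (B nu)^t*) = K%:R * (mu == nu)%:R.
  by rewrite -ortho /hs_inner mulrA divff// mul1r.
rewrite nsqE.
have -> : (\sum_w al w *: B (idx w))^t* = \sum_w (al w)^*%R *: (B (idx w))^t*.
  rewrite raddf_sum map_mx_sum; apply: eq_bigr => w _; exact: adjmxZ.
rewrite mulmx_suml raddf_sum rmorphM rmorph_nat raddf_sum mulr_sumr; apply: eq_bigr
  => w _ /=.
rewrite mulmx_sumr raddf_sum /= (bigD1 w)//= big1 ?addr0.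
  by rewrite -scalemxAl -scalemxAr !mxtraceZ tr eqxx mulr1 -mulC_conj mulrA mulrC.
move=> w' ww'; rewrite -scalemxAl -scalemxAr !mxtraceZ tr.
by rewrite (inj_eq inj) eq_sym (negbTE ww') !mulr0.
Qed.

(** [tri_norm] bounds eigenvalues squared by (4 * 32 * 32)^2 K |a|^2 in terms of the coefficients a
    on the sign matrices. The lower bound K^2 / 4 * |a|^2 <= K |al|^2 turns K |a|^2 into 4 |al|^2,
    where al are the coefficients on the orthonormal basis. *)
Definition eucl_const : R := 4 * (4 * 32 * 32) ^+ 2.

(** H1 and H2 come from the real and imaginary parts of the coefficients on the sign matrices, not
    of [al]: it is real combinations of the sign matrices that are Hermitian. The choice L = K / 128
    + 1, rounded down, satisfies 128 (L - 1) <= K and stays positive for small K. *)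
Lemma near_euclidean_basis (K : nat) : (2 <= K)%N ->
  exists (B : 'I_(K ^ 2) -> 'M[C]_K) (idx : 'I_(K %/ 128).+1 -> 'I_(K ^ 2)),
    [/\ normalized_local_basis B, injective idx, forall w, idx w <> 0%N :> nat
      & forall al, exists H1 H2,
        [/\ \sum_w al w *: B (idx w) = H1 + 'i%C *: H2,
            spec_bound H1 (eucl_const * \sum_w cabs (al w) ^+ 2)
          & spec_bound H2 (eucl_const * \sum_w cabs (al w) ^+ 2)]].
Proof.
move=> K2; set L := (K %/ 128).+1.
have K0 : (0 < K)%N by apply: leq_trans K2.
have LK : (L <= K)%N by rewrite /L; lia.
have LLK : (128 * L.-1 <= K)%N by rewrite /L /=; lia.
have Kr : 0 < K%:R :> R by rewrite ltr0n.
have [tau [tau1 tau2]] := @good_signs R L K K0 isT LK LLK.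
set s := sym_signs R tau in tau1 tau2.
have trib := @tri_norm R L K K0 isT s tau1.
have low := tri_hs_lower K0 K2 tau2.
have sym w x y : s w x y = s w y x by rewrite /s /sym_signs; case: ltngtP.
pose S w : 'M[C]_K := \matrix_(x, y) (s w x y)%:C.
have combE (a : 'I_L -> C) : \sum_w a w *: S w =
    real_comb s (fun w => complex.Re (a w)) + 'i%C *: real_comb s (fun w =>
      complex.Im (a w)).
  apply/matrixP => x y; rewrite summxE !mxE !raddf_sum /= mulr_sumr -big_split /=.
  apply: eq_bigr => w _; rewrite !mxE; case: (a w) => p q /=.
  by apply/eqP; rewrite eq_complex /=; apply/andP; split; apply/eqP; ring.
have nsqcomb (a : 'I_L -> C) : K%:R ^+ 2 / 4 * \sum_w cabs (a w) ^+ 2 <= nsq (\sum_w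
  a w *: S w).
  have -> : nsq (\sum_w a w *: S w) =
      \sum_x \sum_y (\sum_w complex.Re (a w) * s w x y) ^+ 2 +
      \sum_x \sum_y (\sum_w complex.Im (a w) * s w x y) ^+ 2.
    rewrite combE -big_split; apply: eq_bigr => x _ /=; rewrite -big_split.
    apply: eq_bigr => y _ /=; rewrite cabs_sqr !mxE /=.
    by congr (_ ^+ 2 + _ ^+ 2); ring.
  under eq_bigr do rewrite cabs_sqr.
  by rewrite big_split mulrDr lerD// low.
have trS w : \tr (S w) = 0.
  by apply: big1 => x _; rewrite mxE /s /sym_signs ltnn.
have freeS (a : 'I_L -> C) : \sum_w a w *: S w = 0 -> forall w, a w = 0.
  move=> a0 w; have := nsqcomb a; rewrite a0.
  have -> : nsq (0 : 'M[C]_K) = 0.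
    by apply: big1 => x _; apply: big1 => y _; rewrite mxE cabs_sqr /= expr0n addr0.
  rewrite pmulr_rle0 ?divr_gt0 ?exprn_gt0// => h.
  have : cabs (a w) ^+ 2 <= 0.
    apply: le_trans h; rewrite (bigD1 w)//= lerDl sumr_ge0// => ? _; exact: sqr_ge0.
  rewrite cabs_sqr; case: (a w) => p q /= h'.
  have p0 : p = 0 by apply/eqP; rewrite -sqrf_eq0; apply/eqP; have := sqr_ge0 p; have
    := sqr_ge0 q; lra.
  have q0 : q = 0 by apply/eqP; rewrite -sqrf_eq0; apply/eqP; have := sqr_ge0 p; have
    := sqr_ge0 q; lra.
  by rewrite p0 q0.
have [B [idx [basisB inj idx0 comb]]] := exists_local_basis K0 trS freeS.
exists B, idx; split => // al.
have [a aE] := comb al.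
exists (real_comb s (fun w => complex.Re (a w))), (real_comb s (fun w => complex.Im
  (a w))).
have M0 : 0 <= (4 * 32 * 32) ^+ 2 * K%:R :> R by rewrite mulr_ge0 ?sqr_ge0 ?ler0n.
have [_ ortho _] := basisB.
have := nsqcomb a; rewrite -aE (nsq_orthonormal_comb K0 ortho inj).
set al2 := \sum_w cabs (al w) ^+ 2; set a2 := \sum_w cabs (a w) ^+ 2 => h.
have ha : K%:R * a2 <= 4 * al2 by rewrite -(ler_pM2l Kr); lra.
have key (f : 'I_L -> R) : \sum_w f w ^+ 2 <= a2 ->
    (4 * 32 * 32) ^+ 2 * K%:R * \sum_w f w ^+ 2 <= eucl_const * al2.
  move=> hf; have h1 : K%:R * \sum_w f w ^+ 2 <= 4 * al2.
    by apply: le_trans ha; rewrite ler_pM2l.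
  by have := ler_wpM2l (sqr_ge0 (4 * 32 * 32 : R)) h1; rewrite /eucl_const; lra.
split; first by rewrite aE combE.
- apply: (spec_bound_le (key _ _)) (spec_bound_real sym M0 trib _).
  by apply: ler_sum => w _; rewrite cabs_sqr lerDl sqr_ge0.
- apply: (spec_bound_le (key _ _)) (spec_bound_real sym M0 trib _).
  by apply: ler_sum => w _; rewrite cabs_sqr lerDr sqr_ge0.
Qed.

End ComplexMatrices.

(** * Operator bounds and replacement by eigenvalues *)

Section OperatorBound.
Local Open Scope complex_scope.
Local Open Scope sesquilinear_scope.
Variable R : realType.
Local Notation C := R[i].

(* M bounds the square of the operator norm. *)
Definition op_bound n (A : 'M[C]_n) (M : R) : Prop :=
  forall v : 'cV[C]_n, nsq (A *m v) <= M * nsq v.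

Lemma nsqZ m n (c : C) (A : 'M[C]_(m, n)) : nsq (c *: A) = cabs c ^+ 2 * nsq A.
Proof.
rewrite /nsq mulr_sumr; apply: eq_bigr => i _; rewrite mulr_sumr.
by apply: eq_bigr => j _; rewrite mxE cabsM_sqr.
Qed.

Lemma op_boundZ n (c : C) (A : 'M[C]_n) M :
  op_bound A M -> op_bound (c *: A) (cabs c ^+ 2 * M).
Proof.
by move=> h v; rewrite -scalemxAl nsqZ -mulrA ler_wpM2l ?sqr_ge0.
Qed.

Lemma nsqD_le m n (A B : 'M[C]_(m, n)) : nsq (A + B) <= 2 * nsq A + 2 * nsq B.
Proof.
rewrite /nsq !mulr_sumr -big_split; apply: ler_sum => i _ /=.
rewrite !mulr_sumr -big_split; apply: ler_sum => j _ /=.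
rewrite mxE !cabs_sqr; case: (A i j) => a b; case: (B i j) => c d /=.
by have := sqr_ge0 (a - c); have := sqr_ge0 (b - d); lra.
Qed.

Lemma op_boundD n (A B : 'M[C]_n) M M' :
  op_bound A M -> op_bound B M' -> op_bound (A + B) (2 * M + 2 * M').
Proof.
move=> hA hB v; rewrite mulmxDl; apply: le_trans (nsqD_le _ _) _.
by have := hA v; have := hB v; lra.
Qed.

Lemma op_bound1 n : op_bound (1%:M : 'M[C]_n) 1.
Proof. by move=> v; rewrite mul1mx mul1r. Qed.

Lemma nsq_projections n K (P : 'I_K -> 'M[C]_n) (v : 'cV[C]_n) :
  (forall k, (P k)^t* = P k) -> (forall k, P k *m P k = P k) ->
  \sum_k P k = 1%:M -> nsq v = \sum_k nsq (P k *m v).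
Proof.
move=> adj idem tot; apply: (@complexI R); rewrite nsqE_adj raddf_sum.
rewrite -{2}[v]mul1mx -tot mulmx_suml mulmx_sumr raddf_sum; apply: eq_bigr => k _ /=.
by rewrite nsqE_adj adjmxM adj !mulmxA -[_ *m P k *m P k]mulmxA idem.
Qed.

(** [P k] intertwines Z + Y H with Z + lam_k Y, and vectors split orthogonally along the [P k]. The
    pieces add up by Pythagoras, so M is not enlarged. *)
Lemma op_bound_spectral n K (Z Y H : 'M[C]_n) (P : 'I_K -> 'M[C]_n) (lam : 'I_K -> R)
  M :
  (forall k, (P k)^t* = P k) -> (forall k, P k *m P k = P k) -> \sum_k P k = 1%:M ->
  (forall k, P k *m H = (lam k)%:C *: P k) ->
  (forall k, P k *m Z = Z *m P k) -> (forall k, P k *m Y = Y *m P k) ->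
  (forall k, op_bound (Z + (lam k)%:C *: Y) M) ->
  op_bound (Z + Y *m H) M.
Proof.
move=> adj idem tot PH PZ PY hb v.
rewrite (nsq_projections _ adj idem tot) (nsq_projections v adj idem tot) mulr_sumr.
apply: ler_sum => k _.
have -> : P k *m ((Z + Y *m H) *m v) = (Z + (lam k)%:C *: Y) *m (P k *m v).
  rewrite !mulmxA; congr (_ *m v).
  by rewrite mulmxDr mulmxA PZ PY -mulmxA PH -scalemxAr mulmxDl -scalemxAl.
exact: hb.
Qed.

(** Induction on [r] with [Y0] general: once a term is replaced by an eigenvalue multiple of [Y i],
    it commutes with all remaining projections and is absorbed into [Y0]. No step loses a constant,
    so the number of sites is irrelevant to the bound. *)
Lemma op_bound_freeze n K (I : eqType) (r : seq I) (Y0 : 'M[C]_n) (Y H : I -> 'M[C]_n)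
    (P : I -> 'I_K -> 'M[C]_n) (lam : I -> 'I_K -> R) M :
  uniq r ->
  (forall i k, (P i k)^t* = P i k) -> (forall i k, P i k *m P i k = P i k) ->
  (forall i, \sum_k P i k = 1%:M) ->
  (forall i k, P i k *m H i = (lam i k)%:C *: P i k) ->
  (forall i j k, i != j -> P i k *m H j = H j *m P i k) ->
  (forall i j k, P i k *m Y j = Y j *m P i k) ->
  (forall i k, P i k *m Y0 = Y0 *m P i k) ->
  (forall mu : I -> R, (forall i, exists k, mu i = lam i k) ->
     op_bound (Y0 + \sum_(i <- r) (mu i)%:C *: Y i) M) ->
  (0 < K)%N ->
  op_bound (Y0 + \sum_(i <- r) Y i *m H i) M.
Proof.
move=> + adj idem tot PH PHj PY + + K0.
elim: r Y0 => [|i r IH] Y0 /=.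
  move=> _ _ /(_ (fun i => lam i (Ordinal K0))) hb.
  by move: hb; rewrite !big_nil; apply => i; exists (Ordinal K0).
case/andP=> ir ur PY0 hb; rewrite big_cons addrCA [_ + (_ + _)]addrC.
apply: (op_bound_spectral (adj i) (idem i) (tot i) (PH i)) => [k|k|k].
- rewrite mulmxDr mulmxDl PY0; congr (_ + _).
  rewrite mulmx_sumr mulmx_suml; apply: eq_big_seq => j jr.
  rewrite mulmxA PY -!mulmxA PHj//; apply: contraNneq ir => ->; exact: jr.
- exact: PY.
rewrite addrAC; apply: IH => //.
  move=> j k'; rewrite mulmxDr mulmxDl PY0; congr (_ + _).
  by rewrite -scalemxAr -scalemxAl PY.
move=> mu hmu; pose mu' j := if j == i then lam i k else mu j.
have mui : mu' i = lam i k by rewrite /mu' eqxx.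
have := hb mu'; rewrite big_cons mui addrA.
rewrite (eq_big_seq (fun j => (mu j)%:C *: Y j)); last first.
  by move=> j jr; rewrite /mu'; case: eqP => // ji; rewrite -ji jr in ir.
by apply => j; rewrite /mu'; case: eqP => [->|_]; [exists k|exact: hmu].
Qed.

Lemma l2norm_nsq n (v : 'cV[C]_n) : l2norm v = Num.sqrt (nsq v).
Proof. by rewrite /l2norm /nsq; congr Num.sqrt; apply: eq_bigr => i _; rewrite
  big_ord1. Qed.

Lemma opnorm_le n (A : 'M[C]_n) M : 0 <= M -> op_bound A M ->
  0 <= opnorm A <= Num.sqrt M.
Proof.
move=> M0 hA; rewrite /opnorm; set E := [set _ | _ in _]%classic.
have E0 : E 0.
  exists 0; last by rewrite mulmx0 l2norm_nsq /nsq big1 ?sqrtr0// => i _;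
    rewrite big_ord1 mxE cabs_sqr /= expr0n addr0.
  rewrite /= l2norm_nsq /nsq big1 ?sqrtr0 ?ler01// => i _.
  by rewrite big_ord1 mxE cabs_sqr /= expr0n addr0.
have ub : ubound E (Num.sqrt M).
  move=> _ [v /= hv <-]; rewrite !l2norm_nsq in hv *; apply: ler_wsqrtr.
  apply: le_trans (hA v) _; rewrite -[leRHS]mulr1 ler_wpM2l//.
  by rewrite -sqrtr1 ler_sqrt in hv.
apply/andP; split; last by apply: ge_sup => //; exists 0.
by apply: ub_le_sup => //; exists (Num.sqrt M).
Qed.

End OperatorBound.

(** * Tensor products and single-site operators *)

Section Tensors.
Local Open Scope complex_scope.
Local Open Scope sesquilinear_scope.
Variable R : realType.
Local Notation C := R[i].
Variable K : nat.
Implicit Types n : nat.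

Lemma eq_tensor n (X Y : 'I_n -> 'M[C]_K) : X =1 Y -> tensor X = tensor Y.
Proof. by move=> XY; congr tensor; apply/funext. Qed.

Lemma tensor_recS n (X : 'I_n.+2 -> 'M[C]_K) :
  tensor_rec X = X ord0 *t (tensor_rec (fun j => X (lift ord0 j)) : 'M[C]_(K ^ n.+1)).
Proof. by []. Qed.

Lemma tensor_mul n (X Y : 'I_n -> 'M[C]_K) :
  tensor X *m tensor Y = tensor (fun j => X j *m Y j).
Proof.
case: n X Y => [|n] X Y; first by rewrite mulmx1.
rewrite /tensor; elim: n X Y => [//|n IH] X Y.
rewrite [RHS]tensor_recS -IH.
exact: (@tensmx_mul _ _ _ _ _ _ _ (X ord0) (tensor_rec _) (Y ord0) (tensor_rec _)).
Qed.

Lemma adjmx_tens m n (A : 'M[C]_m) (B : 'M[C]_n) : (A *t B)^t* = A^t* *t B^t*.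
Proof. by rewrite trmx_tens map_mxT. Qed.

Lemma tensor_adj n (X : 'I_n -> 'M[C]_K) : (tensor X)^t* = tensor (fun j => (X j)^t*).
Proof.
case: n X => [|n] X; first by rewrite trmx1 map_mx1.
rewrite /tensor; elim: n X => [//|n IH] X.
by rewrite [RHS]tensor_recS -IH; exact: (adjmx_tens (X ord0) (tensor_rec _)).
Qed.

Lemma mxtrace_tens m n (A : 'M[C]_m) (B : 'M[C]_n) : \tr (A *t B) = \tr A * \tr B.
Proof.
rewrite /mxtrace mulr_sum; apply: eq_bigr => i _.
by rewrite mxE.
Qed.

Lemma mxtrace_tensor n (X : 'I_n -> 'M[C]_K) : \tr (tensor X) = \prod_j \tr (X j).
Proof.
case: n X => [|n] X; first by rewrite big_ord0 mxtrace1 expn0.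
rewrite /tensor; elim: n X => [|n IH] X; first by rewrite big_ord1.
by rewrite big_ord_recl -IH; exact: (mxtrace_tens (X ord0) (tensor_rec _)).
Qed.

Lemma tens1mx1 m n : (1%:M : 'M[C]_m) *t (1%:M : 'M[C]_n) = 1%:M.
Proof.
apply/matrixP => i j; case: (mxtens_indexP i) => i1 i2; case: (mxtens_indexP j) => j1
  j2.
rewrite tensmxE !mxE (can_eq (@mxtens_indexK _ _)) xpair_eqE.
by rewrite -natrM mulnb.
Qed.

Lemma tensor1 n : tensor (fun _ : 'I_n => 1%:M : 'M[C]_K) = 1%:M.
Proof.
case: n => [//|n]; rewrite /tensor; elim: n => [//|n IH].
by rewrite tensor_recS IH; exact: (tens1mx1 K (K ^ n.+1)).
Qed.

Definition upd n (X : 'I_n -> 'M[C]_K) (s : 'I_n) (Z : 'M[C]_K) (j : 'I_n) :=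
  if j == s then Z else X j.

Lemma tensor_updP n (X : 'I_n -> 'M[C]_K) s (c : C) Z1 Z2 :
  tensor (upd X s (c *: Z1 + Z2)) = c *: tensor (upd X s Z1) + tensor (upd X s Z2).
Proof.
case: n X s => [|n] X s; first by case: s.
rewrite /tensor; elim: n X s => [|n IH] X s.
  by rewrite /= /upd !ord1 eqxx.
rewrite !tensor_recS; case: (unliftP ord0 s) => [s'|] sE.
  have lf Z : tensor_rec (fun j => upd X s Z (lift ord0 j)) =
      tensor_rec (upd (fun j => X (lift ord0 j)) s' Z).
    by congr tensor_rec; apply/funext => j; rewrite /upd sE (inj_eq lift_inj).
  have l0 Z : upd X s Z ord0 = X ord0 by rewrite /upd sE.
  rewrite !l0 !lf IH; apply/matrixP => i j; rewrite !mxE; ring.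
have lf Z : tensor_rec (fun j => upd X s Z (lift ord0 j)) =
    tensor_rec (fun j => X (lift ord0 j)).
  by congr tensor_rec; apply/funext => j; rewrite /upd sE.
have l0 Z : upd X s Z ord0 = Z by rewrite /upd sE eqxx.
rewrite !l0 !lf; apply/matrixP => i j; rewrite !mxE; ring.
Qed.

Definition site n (s : 'I_n) (Z : 'M[C]_K) : 'M[C]_(K ^ n) :=
  tensor (upd (fun=> 1%:M) s Z).

Lemma site_linear n (s : 'I_n) : linear (site s).
Proof. by move=> c Z1 Z2; exact: tensor_updP. Qed.

HB.instance Definition _ n (s : 'I_n) :=
  GRing.isLinear.Build C 'M[C]_K 'M[C]_(K ^ n) *:%R (site s) (site_linear s).

Lemma site1 n (s : 'I_n) : site s 1%:M = 1%:M.
Proof. by rewrite -[RHS]tensor1; apply: eq_tensor => j; rewrite /upd; case: eqP. Qed.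

Lemma siteM n (s : 'I_n) Z1 Z2 : site s Z1 *m site s Z2 = site s (Z1 *m Z2).
Proof.
rewrite /site tensor_mul; apply: eq_tensor => j.
by rewrite /upd; case: eqP => // _; rewrite mulmx1.
Qed.

Lemma site_adj n (s : 'I_n) Z : (site s Z)^t* = site s (Z^t*).
Proof.
rewrite /site tensor_adj; apply: eq_tensor => j.
by rewrite /upd; case: eqP => // _; rewrite trmx1 map_mx1.
Qed.

Lemma tensor_site n (X : 'I_n -> 'M[C]_K) s Z : X s = 1%:M ->
  tensor X *m site s Z = tensor (upd X s Z).
Proof.
move=> Xs; rewrite /site tensor_mul; apply: eq_tensor => j.
by rewrite /upd; case: eqP => [->|_]; rewrite ?Xs ?mul1mx ?mulmx1.
Qed.

Lemma site_tensor n (X : 'I_n -> 'M[C]_K) s Z : X s = 1%:M ->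
  site s Z *m tensor X = tensor (upd X s Z).
Proof.
move=> Xs; rewrite /site tensor_mul; apply: eq_tensor => j.
by rewrite /upd; case: eqP => [->|_]; rewrite ?Xs ?mul1mx ?mulmx1.
Qed.

Lemma site_comm n (s s' : 'I_n) Z Z' : s != s' -> site s Z *m site s' Z' = site s' Z'
  *m site s Z.
Proof.
move=> ss'; rewrite {2 3}/site.
by rewrite site_tensor ?tensor_site// /upd (negbTE ss').
Qed.

End Tensors.

(** * Fourier matrices of arbitrary order *)

Section Flat.
Local Open Scope complex_scope.
Local Open Scope sesquilinear_scope.
Variable R : realType.
Local Notation C := R[i].

Lemma prim_root_exists (F : numClosedFieldType) n : (0 < n)%N -> exists z : F,
  n.-primitive_root z.
Proof.
move=> n0; pose p : {poly F} := 'X^n - 1.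
have [r pE] := closed_field_poly_normal p.
have szp : size p = n.+1 by rewrite /p size_XnsubC.
have lp : lead_coef p = 1 by apply/monicP; rewrite /p -polyC1 monicXnsubC.
rewrite lp scale1r in pE.
have rn : all n.-unity_root r.
  apply/allP => z zr; have -> : n.-unity_root z = root p z by [].
  by rewrite pE root_prod_XsubC.
have sz : size r = n by have := congr1 (fun q : {poly F} => size q) pE; rewrite szp
  size_prod_XsubC => -[].
have ur : uniq r.
  by rewrite -separable_prod_XsubC -pE; apply: separable_Xn_sub_1; rewrite pnatr_eq0
    -lt0n.
have := has_prim_root n0 rn ur; rewrite sz leqnn => /(_ isT)/hasP[z _ zP].
by exists z.
Qed.

(** The Fourier matrix z^(ij) of a primitive root of unity z of order |Q|. Orthogonality of distinct
    rows is the vanishing of a geometric sum whose ratio is a nontrivial |Q|-th root of unity. *)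
Lemma flat_matrix_exists (Q : finType) : exists V : Q -> Q -> C,
  (forall i k, cabs (V i k) = 1) /\
  forall lam : Q -> C, \sum_k cabs (\sum_i lam i * V i k) ^+ 2 = #|Q|%:R * \sum_i
    cabs (lam i) ^+ 2.
Proof.
have [Q0|Qn0] := posnP #|Q|.
  exists (fun _ _ => 1); split; first by move=> i; have := fintype0 i Q0.
  by move=> lam; rewrite Q0 mul0r big1// => i; have := fintype0 i Q0.
have [z zP] := prim_root_exists C Qn0.
have zn := prim_expr_order zP.
have nz : `|z| = 1.
  apply/eqP; rewrite -(@pexpr_eq1 _ _ #|Q|)//.
  by rewrite -normrX zn normr1.
have z0 : z != 0 by rewrite -normr_eq0 nz oner_eq0.
have zc : z^*%R = z^-1.
  by apply: (mulfI z0); rewrite divff// -normCK nz expr1n.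
pose V (i k : Q) : C := z ^+ (enum_rank i * enum_rank k).
exists V; split.
  by move=> i k; rewrite /cabs normrX nz expr1n.
move=> lam; apply: (@complexI R).
rewrite raddf_sum rmorphM rmorph_nat raddf_sum /=.
have orth i j : \sum_k V i k * (V j k)^*%R = #|Q|%:R * (i == j)%:R.
  rewrite (eq_bigr (fun k : Q => (z ^+ enum_rank i / z ^+ enum_rank j) ^+ enum_rank
    k)); last first.
    by move=> k _; rewrite /V rmorphXn /= zc exprVn expr_div_n -!exprM.
  set y := _ / _.
  case: eqVneq => [ij|ij].
    have y1 : y = 1 by rewrite /y ij divff// expf_neq0.
    by rewrite (eq_bigr (fun=> 1)) ?sumr_const ?mulr1// => k _; rewrite y1 expr1n.
  have y1 : y - 1 != 0.
    rewrite subr_eq0 /y -(inj_eq (mulIf (expf_neq0 (enum_rank j) z0))) mul1r divfK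
      ?expf_neq0//.
    rewrite (eq_prim_root_expr zP) !modn_small//.
    by apply: contra_neq ij => /ord_inj /enum_rank_inj.
  rewrite (reindex (@enum_val Q predT)) /=; last exact: onW_bij (enum_val_bij _).
  under eq_bigr do rewrite enum_valK.
  apply: (mulfI y1); rewrite -subrX1 mulr0 mulr0 /y expr_div_n -!exprM.
  by rewrite ![(_ * #|Q|)%N]mulnC !exprM zn !expr1n divr1 subrr.
under eq_bigr do rewrite -mulC_conj rmorph_sum mulr_suml.
rewrite exchange_big mulr_sumr; apply: eq_bigr => i _ /=.
under eq_bigr do rewrite mulr_sumr.
rewrite exchange_big (bigD1 i)//= [X in _ + X]big1 ?addr0.
  rewrite (eq_bigr (fun k => lam i * (lam i)^*%R * (V i k * (V i k)^*%R))).
    by rewrite -mulr_sumr orth eqxx mulr1 mulrC mulC_conj.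
  by move=> k _; rewrite rmorphM /= mulrACA.
move=> j ji.
rewrite (eq_bigr (fun k => lam i * (lam j)^*%R * (V i k * (V j k)^*%R))).
  by rewrite -mulr_sumr orth eq_sym (negbTE ji) !mulr0.
by move=> k _; rewrite rmorphM /= mulrACA.
Qed.

End Flat.

(** * The recursive operator *)

Section SiteFreeze.
Local Open Scope complex_scope.
Local Open Scope sesquilinear_scope.
Variable R : realType.
Local Notation C := R[i].

Lemma adj_delta K (k : 'I_K) : (delta_mx k k : 'M[C]_K)^t* = delta_mx k k.
Proof. by rewrite trmx_delta map_delta_mx. Qed.

(** The eigenprojections of [H i] are placed at site [s i]. Injectivity of [s] makes them commute
    with the [H j] at the other sites, and [comm] makes them commute with every [Y j], as the
    freezing argument requires. *)
Lemma op_bound_site K n (Q : finType) (s : Q -> 'I_n) (Y : Q -> 'M[C]_(K ^ n))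
    (H : Q -> 'M[C]_K) (m : Q -> R) M :
  (0 < K)%N -> injective s -> (forall i, spec_bound (H i) (m i)) ->
  (forall i j Z, site (s i) Z *m Y j = Y j *m site (s i) Z) ->
  (forall mu : Q -> R, (forall i, mu i ^+ 2 <= m i) ->
     op_bound (\sum_i (mu i)%:C *: Y i) M) ->
  op_bound (\sum_i Y i *m site (s i) (H i)) M.
Proof.
move=> K0 inj spec comm hb.
have /choice[pl plP] : forall i, exists pl : 'M[C]_K * ('I_K -> R),
    [/\ pl.1 \is unitarymx, H i = pl.1^t* *m diag_mx (\row_k (pl.2 k)%:C) *m pl.1
      & forall k, pl.2 k ^+ 2 <= m i].
  by move=> i; have [P [lam h]] := spec i; exists (P, lam).
pose U i := (pl i).1; pose lam i := (pl i).2.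
have Uu i : U i *m (U i)^t* = 1%:M by apply/unitarymxP; have [] := plP i.
have uU i : (U i)^t* *m U i = 1%:M by apply: mulmx1C; exact: Uu.
pose p i k : 'M[C]_K := (U i)^t* *m delta_mx k k *m U i.
have padj i k : (p i k)^t* = p i k.
  by rewrite /p !adjmxM trmxCK adj_delta mulmxA.
have pidem i k : p i k *m p i k = p i k.
  by rewrite /p !mulmxA -(mulmxA _ (U i)) Uu mulmx1 -(mulmxA _ _ (delta_mx k k))
    mul_delta_mx.
have ptot i : \sum_k p i k = 1%:M.
  by rewrite /p -mulmx_suml -mulmx_sumr -mx1_sum_delta mulmx1 uU.
have pH i k : p i k *m H i = (lam i k)%:C *: p i k.
  have [_ HE _] := plP i; rewrite HE -/(U i) /p !mulmxA -(mulmxA _ (U i)) Uu mulmx1.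
  suff hd : delta_mx k k *m diag_mx (\row_k' ((pl i).2 k')%:C) = (lam i k)%:C *:
    delta_mx k k :> 'M[C]_K.
    by rewrite -[_ *m delta_mx k k *m diag_mx _]mulmxA hd -scalemxAr -scalemxAl.
  apply/matrixP => a b; rewrite !mxE (bigD1 k)//= big1 ?addr0.
    rewrite !mxE eqxx andbT; case: (a == k); rewrite ?mul0r ?mulr0//=.
    by rewrite mul1r [b == k]eq_sym; have [->|] := eqVneq k b;
      rewrite ?mulr1n ?mulr0n ?mulr1 ?mulr0.
  by move=> c ck; rewrite !mxE (negbTE ck) andbF mul0r.
have eqs : \sum_i Y i *m site (s i) (H i) = 0 + \sum_(i <- enum Q) Y i *m site (s i)
  (H i).
  by rewrite add0r big_enum.
rewrite eqs.
apply: (@op_bound_freeze _ _ K _ _ _ _ _ (fun i k => site (s i) (p i k)) lam) => //.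
- exact: enum_uniq.
- by move=> i k; rewrite site_adj padj.
- by move=> i k; rewrite siteM pidem.
- by move=> i; rewrite -raddf_sum /= ptot site1.
- by move=> i k; rewrite siteM pH linearZ.
- by move=> i j k ij; apply: site_comm; rewrite (inj_eq inj).
- by move=> i k; rewrite mulmx0 mul0mx.
move=> mu hmu; rewrite add0r big_enum; apply: hb => i.
by have [k ->] := hmu i; have [_ _ h] := plP i; exact: h.
Qed.

End SiteFreeze.

Section Recursion.
Local Open Scope complex_scope.
Local Open Scope sesquilinear_scope.
Variable R : realType.
Local Notation C := R[i].
Variable L : nat.

(* qidx t indexes both the sites of block t and the operators Y_t; an element of
   qpath t is a choice of one site and one basis element in each block below t. *)
Fixpoint qidx (t : nat) : finType :=
  if t is t'.+1 then (qidx t' * 'I_L)%type else unit.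

Fixpoint qpath (t : nat) : finType :=
  if t is t'.+1 then (qpath t' * qidx t'.+1)%type else unit.

Definition qend t : qpath t -> qidx t :=
  match t with 0 => fun _ => tt | t'.+1 => fun p => p.2 end.

Lemma card_qidx t : #|qidx t| = (L ^ t)%N.
Proof. by elim: t => [|t IH]; rewrite ?card_unit//= card_prod IH card_ord expnSr. Qed.

Lemma card_qpath t : #|qpath t| = (\prod_(j < t) L ^ j.+1)%N.
Proof.
elim: t => [|t IH]; first by rewrite big_ord0 card_unit.
by rewrite big_ord_recr /= card_prod IH card_prod card_qidx card_ord expnSr.
Qed.

Variable V : forall t, qidx t -> qidx t -> C.
Hypothesis V1 : forall t i k, cabs (@V t i k) = 1.
Hypothesis Viso : forall t (lam : qidx t -> C),
  \sum_k cabs (\sum_i lam i * V i k) ^+ 2 = #|qidx t|%:R * \sum_i cabs (lam i) ^+ 2.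

Fixpoint coef t : qpath t -> C :=
  match t with
  | 0 => fun _ => 1
  | t'.+1 => fun p => coef p.1 * V p.2.1 (qend p.1)
  end.

Lemma cabs_coef t (p : qpath t) : cabs (coef p) = 1.
Proof.
suff : cabs (coef p) ^+ 2 = 1.
  by move/eqP; rewrite sqrp_eq1 ?cabs_ge0// => /eqP.
elim: t p => [|t IH] p /=; first by rewrite cabs_sqr /= expr0n addr0 expr1n.
by rewrite cabsM_sqr IH V1 expr1n mulr1.
Qed.

Variables (K n d : nat).
Hypothesis K0 : (0 < K)%N.
Variable s : forall t, qidx t -> 'I_n.
Hypothesis s_inj : forall t, (t < d)%N -> injective (@s t).
Hypothesis s_disj : forall t t' i j, (t < t')%N -> (t' < d)%N -> @s t i <> @s t' j.

Variable B : 'I_(K ^ 2) -> 'M[C]_K.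
Hypothesis basisB : normalized_local_basis B.
Variable idx : 'I_L -> 'I_(K ^ 2).
Hypothesis idx_inj : injective idx.
Hypothesis idx0 : forall w, idx w <> 0%N :> nat.
Variable c : R.
Hypothesis c0 : 0 <= c.
Hypothesis near : forall al, exists H1 H2,
  [/\ \sum_w al w *: B (idx w) = H1 + 'i%C *: H2,
      spec_bound H1 (c * \sum_w cabs (al w) ^+ 2)
    & spec_bound H2 (c * \sum_w cabs (al w) ^+ 2)].

Let K20 : (0 < K ^ 2)%N. Proof. by rewrite expn_gt0 K0. Qed.
Let z0 : 'I_(K ^ 2) := Ordinal K20.

Fixpoint midx t : qpath t -> 'I_n -> 'I_(K ^ 2) :=
  match t with
  | 0 => fun _ _ => z0
  | t'.+1 => fun p j => if j == s p.2.1 then idx p.2.2 else midx p.1 j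
  end.

Lemma midx_out t (p : qpath t) j :
  (forall t' i, (t' < t)%N -> @s t' i <> j) -> midx p j = z0.
Proof.
elim: t p => [//|t IH] [p [i w]] /= h.
have -> : (j == s i) = false by apply/eqP => /esym; exact: h.
by apply: IH => t' i' tt'; apply: h; exact: ltnW.
Qed.

Lemma midx_fresh t t' (p : qpath t) (i : qidx t') :
  (t <= t')%N -> (t' < d)%N -> midx p (s i) = z0.
Proof.
move=> tt' td; apply: midx_out => t'' i' h; apply: s_disj => //.
exact: leq_trans tt'.
Qed.

(** In the last block exactly one site carries a nonzero index; it reveals both i and w, and off
    that site the multi-indices are those of the shorter paths. Hence distinct paths never add up in
    one Fourier coefficient. *)
Lemma midx_inj t (p p' : qpath t) : (t <= d)%N -> midx p =1 midx p' -> p = p'.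
Proof.
elim: t p p' => [|t IH]; first by case=> -[].
move=> [p [i w]] [p' [i' w']] td /= h.
have nz w0 : idx w0 <> z0 by move=> e; apply: (idx0 (w := w0)); rewrite e.
have ii' : i = i'.
  apply: contrapT => ii'; have := h (s i); rewrite eqxx.
  have -> : (s i == s i') = false by apply/eqP => /(s_inj td).
  by rewrite midx_fresh// => /nz.
subst i'; have ww' : w = w' by have := h (s i); rewrite eqxx => /idx_inj.
subst w'; congr (_, _); apply: IH (ltnW td) _ => j.
have := h j; case: eqP => // -> _.
by rewrite !midx_fresh.
Qed.

Lemma card_support t (p : qpath t) : (t <= d)%N -> #|[set j | midx p j != z0]| = t.
Proof.
elim: t p => [|t IH] p td.
  by apply/eqP; rewrite cards_eq0; apply/eqP/setP => j; rewrite !inE eqxx.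
case: p => p [i w] /=.
have -> : [set j | (if j == s i then idx w else midx p j) != z0] =
    s i |: [set j | midx p j != z0].
  have nzw : idx w != z0 by apply/eqP => e; apply: (idx0 (w := w)); rewrite e.
  by apply/setP => j; rewrite !inE; case: (j == s i).
by rewrite cardsU1 inE midx_fresh// eqxx IH// ltnW.
Qed.

Definition mono t (p : qpath t) : 'M[C]_(K ^ n) := tensor (fun j => B (midx p j)).

Lemma Bz0 : B z0 = 1%:M.
Proof. by have [h _ _] := basisB; apply: h. Qed.

Lemma monoS t (p : qpath t) i w : (t < d)%N ->
  @mono t.+1 (p, (i, w)) = mono p *m site (s i) (B (idx w)).
Proof.
move=> td; rewrite tensor_site; last by rewrite midx_fresh// Bz0.
by apply: eq_tensor => j /=; rewrite /upd; case: eqP.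
Qed.

Lemma mono_comm t (p : qpath t) (i : qidx t) Z : (t < d)%N ->
  site (s i) Z *m mono p = mono p *m site (s i) Z.
Proof.
by move=> td; rewrite site_tensor ?tensor_site// midx_fresh// Bz0.
Qed.

(** The combination of the Y_{t,k} with coefficients al_k, given directly by its Fourier expansion;
    the recursion defining the Y_t is recovered in [poly_opS]. *)
Definition poly_op t (al : qidx t -> C) : 'M[C]_(K ^ n) :=
  \sum_(p : qpath t) (al (qend p) * coef p) *: mono p.

Lemma poly_op_sum t (I : finType) (mu : I -> C) (al : I -> qidx t -> C) :
  \sum_i mu i *: poly_op (al i) = poly_op (fun k => \sum_i mu i * al i k).
Proof.
under eq_bigr do rewrite /poly_op scaler_sumr.
rewrite exchange_big; apply: eq_bigr => p _ /=.
rewrite mulr_suml scaler_suml; apply: eq_bigr => i _.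
by rewrite scalerA mulrA.
Qed.

Lemma poly_opS t (al : qidx t.+1 -> C) : (t < d)%N ->
  poly_op al = \sum_i poly_op (V i) *m site (s i) (\sum_w al (i, w) *: B (idx w)).
Proof.
move=> td; rewrite /poly_op /=.
rewrite -(pair_bigA _ (fun p q => (al q * (coef p * V q.1 (qend p))) *: @mono t.+1
  (p, q))) /=.
rewrite exchange_big /=.
transitivity (\sum_i \sum_w \sum_p (al (i, w) * (coef p * V i (qend p))) *: @mono
  t.+1 (p, (i, w))).
  by rewrite [RHS]pair_bigA; apply: eq_bigr => -[].
apply: eq_bigr => i _; rewrite mulmx_suml exchange_big; apply: eq_bigr => p _ /=.
rewrite raddf_sum mulmx_sumr; apply: eq_bigr => w _ /=.
rewrite monoS// linearZ /= -scalemxAl -scalemxAr scalerA; congr (_ *: _); ring.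
Qed.

(** One step multiplies the squared bound by 4 c L^t: c bounds the squared eigenvalues, L^t is the
    isometry factor [Viso] of the Fourier matrix, and 4 is the price of adding the H1 and i H2 parts
    by [op_boundD]. *)
Lemma poly_op_bound t (al : qidx t -> C) : (t <= d)%N ->
  op_bound (poly_op al) ((4 * c) ^+ t * (\prod_(j < t) L ^ j)%:R * \sum_k cabs (al k)
    ^+ 2).
Proof.
elim: t al => [|t IH] al td.
  rewrite big_ord0 mulr1 expr0 mul1r.
  have -> : poly_op al = al tt *: 1%:M.
    rewrite /poly_op /= (bigD1 tt)//= big1 ?addr0; last by case.
    by rewrite mulr1 /mono /= Bz0 tensor1.
  have -> : \sum_k cabs (al k) ^+ 2 = cabs (al tt) ^+ 2 * 1.
    by rewrite (bigD1 tt)//= big1 ?addr0 ?mulr1//; case.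
  by apply: (@op_boundZ R _ (al tt) 1%:M 1); exact: op_bound1.
have {}IH al' := IH al' (ltnW td).
have /choice[H1 /choice[H2 hH]] := fun i => near (fun w => al (i, w)).
pose m i := c * \sum_w cabs (al (i, w)) ^+ 2.
set W := (4 * c) ^+ t * (\prod_(j < t) L ^ j)%:R in IH.
have comm (i j : qidx t) Z : site (s i) Z *m poly_op (V j) = poly_op (V j) *m site (s
  i) Z.
  rewrite /poly_op mulmx_sumr mulmx_suml; apply: eq_bigr => p _.
  by rewrite -scalemxAr -scalemxAl mono_comm.
have totE : \sum_k cabs (al k) ^+ 2 = \sum_i \sum_w cabs (al (i, w)) ^+ 2.
  by rewrite [RHS]pair_bigA; apply: eq_bigr => -[].
have hmu (mu : qidx t -> R) : (forall i, mu i ^+ 2 <= m i) ->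
    op_bound (\sum_i (mu i)%:C *: poly_op (V i)) (W * ((L ^ t)%:R * (c * \sum_k cabs
      (al k) ^+ 2))).
  move=> hm; rewrite poly_op_sum.
  have -> : W * ((L ^ t)%:R * (c * \sum_k cabs (al k) ^+ 2)) =
      W * ((L ^ t)%:R * \sum_i m i) by rewrite totE /m -mulr_sumr.
  move=> v; apply: le_trans (IH _ v) _; rewrite ler_wpM2r ?nsq_ge0// ler_wpM2l//.
    by rewrite mulr_ge0 ?exprn_ge0 ?mulr_ge0 ?ler0n.
  rewrite Viso card_qidx ler_wpM2l ?ler0n//; apply: ler_sum => i _.
  by rewrite cabs_sqr_real.
have part (H : qidx t -> 'M[C]_K) : (forall i, spec_bound (H i) (m i)) ->
    op_bound (\sum_i poly_op (V i) *m site (s i) (H i)) (W * ((L ^ t)%:R * (c *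
      \sum_k cabs (al k) ^+ 2))).
  move=> hs; apply: (op_bound_site K0 (s_inj td) hs comm hmu).
rewrite poly_opS//.
have -> : \sum_i poly_op (V i) *m site (s i) (\sum_w al (i, w) *: B (idx w)) =
    \sum_i poly_op (V i) *m site (s i) (H1 i) +
    'i%C *: \sum_i poly_op (V i) *m site (s i) (H2 i).
  rewrite scaler_sumr -big_split; apply: eq_bigr => i _ /=.
  by have [-> _ _] := hH i; rewrite [H1 i + _]addrC site_linear mulmxDr -scalemxAr
    [LHS]addrC.
have h1 := part H1 (fun i => let: And3 _ h _ := hH i in h).
have h2 := op_boundZ 'i%C (part H2 (fun i => let: And3 _ _ h := hH i in h)).
have := op_boundD h1 h2.
have -> : cabs ('i%C : C) ^+ 2 = 1 by rewrite cabs_sqr /=; ring.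
rewrite big_ord_recr /= natrM exprS /W; set P := (\prod_(_ < t) _)%N%:R.
set X := \sum_k _.
by congr (op_bound _ _); ring.
Qed.

End Recursion.

(** * Fourier coefficients and the lower bound *)

Section Fourier.
Local Open Scope complex_scope.
Local Open Scope sesquilinear_scope.
Variable R : realType.
Local Notation C := R[i].
Variables (K n : nat) (B : 'I_(K ^ 2) -> 'M[C]_K).
Hypothesis basisB : normalized_local_basis B.

Lemma fourier_coef_tensor (m : 'I_n -> 'I_(K ^ 2)) (b : {ffun 'I_n -> 'I_(K ^ 2)}) :
  fourier_coef B (tensor (fun j => B (m j))) b = (finfun m == b)%:R.
Proof.
have [_ ortho _] := basisB.
rewrite /fourier_coef tensor_adj tensor_mul mxtrace_tensor.
have -> : (K%:R ^+ n)^-1 = \prod_(j < n) K%:R^-1 :> C.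
  by rewrite prodr_const card_ord exprVn.
rewrite -big_split /= (eq_bigr (fun j => (m j == b j)%:R)); last first.
  by move=> j _; rewrite -ortho.
have [<-|mb] := eqVneq; first by rewrite big1// => j _; rewrite ffunE eqxx.
have [j mbj] : exists j, m j != b j.
  apply/existsP; apply: contraNT mb; rewrite negb_exists => /forallP h.
  by apply/eqP/ffunP => j; rewrite ffunE; apply/eqP; rewrite -[_ == _]negbK.
by rewrite (bigD1 j)//= (negbTE mbj) mul0r.
Qed.

Lemma fourier_coef_sum (P : finType) (a : P -> C) (M : P -> 'M[C]_(K ^ n)) b :
  fourier_coef B (\sum_p a p *: M p) b = \sum_p a p * fourier_coef B (M p) b.
Proof.
rewrite /fourier_coef mulmx_suml raddf_sum mulr_sumr; apply: eq_bigr => p _ /=.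
by rewrite -scalemxAl mxtraceZ mulrCA.
Qed.

(** The sum of p-th powers counts the distinct multi-indices. The exponent is nonzero so that
    vanishing coefficients contribute 0, since [powR] has 0 ^ 0 = 1. *)
Lemma fourier_lp_flat (P : finType) (a : P -> C) (m : P -> 'I_n -> 'I_(K ^ 2)) (p : R) :
  p != 0 -> (forall q, cabs (a q) = 1) -> (forall q q', m q =1 m q' -> q = q') ->
  fourier_lp B (\sum_q a q *: tensor (fun j => B (m q j))) p = #|P|%:R `^ p^-1.
Proof.
move=> p0 a1 minj; rewrite /fourier_lp; congr (_ `^ _).
pose f q := finfun (m q).
have finj : injective f.
  by move=> q q' /ffunP e; apply: minj => j; have := e j; rewrite !ffunE.
rewrite (eq_bigr (fun b => (b \in codom f)%:R)); last first.
  move=> b _; rewrite fourier_coef_sum.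
  under eq_bigr do rewrite fourier_coef_tensor -/(f _).
  have [/codomP[q ->]|bf] := boolP (b \in codom f).
    rewrite (bigD1 q)//= eqxx mulr1 big1 ?addr0 ?a1 ?powR1//.
    by move=> q' qq'; rewrite (inj_eq finj) (negbTE qq') mulr0.
  rewrite big1; first by rewrite /cabs normr0 /= powR0.
  move=> q _; have [e|_] := eqVneq; last by rewrite mulr0.
  by move: bf; rewrite -e codom_f.
by rewrite -natr_sum -(card_codom finj) -sum1_card [in RHS]big_mkcond.
Qed.

Lemma homogeneous_sum (P : finType) (a : P -> C) (m : P -> 'I_n -> 'I_(K ^ 2)) d :
  (forall q, #|[set j | val (m q j) != 0%N]| = d) ->
  homogeneous d (\sum_q a q *: tensor (fun j => B (m q j))).
Proof.
move=> supp; have [B0 ortho _] := basisB.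
pose S q := [set j | val (m q j) != 0%N].
exists (fun T => \sum_(q | S q == T) a q *: tensor (fun j => B (m q j))); split; last
  first.
  rewrite (partition_big S (fun T => #|T| == d))//=.
  by move=> q _; rewrite -(supp q).
(* Monomials with support other than T stay in the list as zero terms: the zero matrix is both
   traceless and scalar, so it satisfies [in_factor] at every site. *)
move=> T Td; exists #|P|, (fun k => if S (enum_val k) == T then a (enum_val k) else 0).
exists (fun k j => if S (enum_val k) == T then B (m (enum_val k) j) else 0); split.
  move=> k j; case: eqP => [<-|_]; last first.
    by case: ifP => _; [rewrite raddf0 | rewrite -(scale0r 1%:M) scalemx1
      scalar_mx_is_scalar].
  rewrite inE; case: (eqVneq (val (m (enum_val k) j)) 0%N) => [e|ne] /=.
    by rewrite (B0 _ e) scalar_mx_is_scalar.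
  have K20 : (0 < K ^ 2)%N by apply: leq_ltn_trans (ltn_ord (m (enum_val k) j)).
  have Kn0 : K%:R^-1 != 0 :> C.
    rewrite invr_eq0 pnatr_eq0; apply: contraTneq K20 => ->; by rewrite exp0n.
  have := ortho (m (enum_val k) j) (Ordinal K20).
  rewrite /hs_inner [B (Ordinal _)]B0// trmx1 map_mx1 mulmx1.
  have -> : (m (enum_val k) j == Ordinal K20) = false by apply/negbTE; apply: contra
    ne => /eqP ->.
  by move/eqP; rewrite mulf_eq0 (negbTE Kn0) => /eqP.
rewrite big_mkcond (reindex (@enum_val P predT)) /=; last exact: onW_bij
  (enum_val_bij _).
rewrite (eq_bigl predT) //; apply: eq_bigr => k _.
by case: ifP => _; rewrite ?scale0r.
Qed.

End Fourier.

(** * From the extremal operator to the growth rate *)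

Section Main.
Local Open Scope complex_scope.
Local Open Scope sesquilinear_scope.
Variable R : realType.
Local Notation C := R[i].

Lemma sites_exist (L d : nat) : (0 < L)%N -> (0 < d)%N ->
  exists n, exists s : forall t, qidx L t -> 'I_n,
    (forall t, (t < d)%N -> injective (@s t)) /\
    (forall t t' i j, (t < t')%N -> (t' < d)%N -> @s t i <> @s t' j).
Proof.
move=> L0 d0; set q := (L ^ d)%N; have q0 : (0 < q)%N by rewrite expn_gt0 L0.
have n0 : (0 < d * q)%N by rewrite muln_gt0 d0.
pose f t (i : qidx L t) := (t * q + enum_rank i)%N.
have rq t (i : qidx L t) : (t < d)%N -> (enum_rank i < q)%N.
  move=> td; apply: leq_trans (ltn_ord _) _.
  by rewrite card_qidx leq_pexp2l// ltnW.
have fn t (i : qidx L t) : (t < d)%N -> (f t i < d * q)%N.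
  move=> td; apply: (@leq_trans (t.+1 * q)); last by rewrite leq_mul2r td orbT.
  by rewrite mulSn [(q + _)%N]addnC /f ltn_add2l rq.
(* Every block gets q = L^d consecutive sites, enough for each t < d; [insubd] falls back on its
   default only for t >= d, where nothing is claimed. *)
exists (d * q)%N, (fun t i => insubd (Ordinal n0) (f t i)); split.
  move=> t td i j /(congr1 val); rewrite !val_insubd !fn// => /addnI /ord_inj.
  exact: enum_rank_inj.
move=> t t' i j tt' td' /(congr1 val); rewrite !val_insubd !fn ?(ltn_trans tt' td')//
  => e.
have : (f t i < f t' j)%N.
  apply: (@leq_trans (t.+1 * q)); last by apply: leq_trans (leq_addr _ _); rewrite
    leq_mul2r tt' orbT.
  by rewrite mulSn [(q + _)%N]addnC /f ltn_add2l rq// (ltn_trans tt').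
by rewrite e ltnn.
Qed.

Lemma extremal_operator (K d : nat) (L := (K %/ 128).+1) : (2 <= K)%N -> (0 < d)%N ->
  exists n (B : 'I_(K ^ 2) -> 'M[C]_K) (A : 'M[C]_(K ^ n)),
    [/\ normalized_local_basis B, homogeneous d A,
      fourier_lp B A (p_exp R d) = (\prod_(j < d) L ^ j.+1)%:R `^ (p_exp R d)^-1
    & 0 <= opnorm A <= Num.sqrt ((4 * eucl_const R) ^+ d * (\prod_(j < d) L ^
      j.+1)%:R)].
Proof.
move=> K2 d0; have K0 : (0 < K)%N by apply: leq_trans K2.
have [B [idx [basisB inj idx0 near]]] := near_euclidean_basis R K2.
have [n [s [sinj sdisj]]] := @sites_exist L d isT d0.
pose V t := sval (cid (flat_matrix_exists R (qidx L t))).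
have VP t := svalP (cid (flat_matrix_exists R (qidx L t))).
have V1 t i k : cabs (V t i k) = 1 by have [h _] := VP t; exact: h.
have Viso t (lam : qidx L t -> C) := (VP t).2 lam.
have c0 : 0 <= eucl_const R by rewrite mulr_ge0 ?sqr_ge0.
pose A := poly_op V K0 s B idx (fun _ : qidx L d => 1).
have AE : A = \sum_(q : qpath L d) coef V q *: tensor (fun j => B (midx K0 s idx q j)).
  by apply: eq_bigr => q _; rewrite mul1r.
exists n, B, A; split=> //.
- rewrite AE; apply: homogeneous_sum => // q.
  rewrite -[RHS](card_support K0 sdisj idx0 q (leqnn d)).
  by apply: eq_card => j; rewrite !inE.
- rewrite AE fourier_lp_flat//.
  + by rewrite card_qpath.
  + by rewrite /p_exp mulf_neq0 ?invr_eq0 ?pnatr_eq0// muln_eq0 -lt0n d0.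
  + by move=> q; apply: cabs_coef.
  + by move=> q q'; apply: (midx_inj (d := d)).
have := poly_op_bound Viso K0 sinj sdisj basisB c0 near (fun _ : qidx L d => 1)
  (leqnn d).
have -> : \sum_(k : qidx L d) cabs (1 : C) ^+ 2 = (L ^ d)%:R.
  rewrite (eq_bigr (fun=> 1)) ?sumr_const ?card_qidx// => k _.
  by rewrite cabs_sqr /= expr0n addr0 expr1n.
rewrite -mulrA -natrM => hb.
(* The all-ones vector contributes L^d, the factor that completes the product of the L^j to N. *)
have -> : (\prod_(j < d) L ^ j.+1 = (\prod_(j < d) L ^ j) * L ^ d)%N.
  transitivity (\prod_(j < d.+1) L ^ j)%N; last by rewrite big_ord_recr.
  by rewrite big_ord_recl expn0 mul1n.
by apply: opnorm_le => //; rewrite mulr_ge0 ?ler0n// exprn_ge0// mulr_ge0.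
Qed.

(** With N = L^(d(d+1)/2), the l_{p_d} norm is L^((d+1)^2/4) and sqrt N is L^(d(d+1)/4). Their
    quotient L^((d+1)/4) is at least L^(d/4), and the constants of the norm bound account for the
    d-th power of the denominator. *)
Lemma bh_const_ge (K d : nat) : (2 <= K)%N -> (0 < d)%N ->
  ((((K %/ 128).+1%:R `^ 4^-1 / Num.sqrt (4 * eucl_const R)) ^+ d)%:E <= bh_const R d
    K)%E.
Proof.
move=> K2 d0; set L := (K %/ 128).+1; set e := Num.sqrt _.
have sumE m : (2 * (\sum_(j < m) j.+1) = m * m.+1)%N.
  elim: m => [|m IH]; first by rewrite big_ord0.
  by rewrite big_ord_recr /= mulnDr IH; lia.
have cp : 0 < 4 * eucl_const R by rewrite /eucl_const !mulr_gt0 ?exprn_gt0 ?mulr_gt0.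
have ep : 0 < e by rewrite sqrtr_gt0.
have [n [B [A [basisB homA fA /andP[op0 opA]]]]] := extremal_operator K2 d0.
apply: le_ereal_inf_tmp => _ /= [D hD <-]; rewrite lee_fin.
have := hD n B basisB A homA; rewrite fA -/L => hDA.
set N := (\prod_(j < d) L ^ j.+1)%N in fA opA hDA.
have L1 : 1 <= L%:R :> R by rewrite ler1n.
have Lp : 0 < L%:R :> R by rewrite ltr0n.
have dn0 : d%:R != 0 :> R by rewrite pnatr_eq0 -lt0n.
have dp : 0 < d%:R :> R by rewrite ltr0n.
have NE : N%:R = L%:R `^ (d%:R * (d%:R + 1) / 2) :> R.
  have -> : N = (L ^ (\sum_(j < d) j.+1))%N by rewrite /N expn_sum.
  rewrite natrX -powR_mulrn ?ler0n//; congr (_ `^ _).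
  by have /(congr1 (fun k : nat => k%:R : R)) := sumE d; rewrite !natrM
    -[d.+1%:R]natr1; lra.
have pE : (p_exp R d)^-1 = (d%:R + 1) / (2 * d%:R).
  by rewrite /p_exp invf_div natrM natr1.
have opA' : opnorm A <= e ^+ d * L%:R `^ (d%:R * (d%:R + 1) / 4).
  apply: le_trans opA _; rewrite sqrtrM ?exprn_ge0 ?(ltW cp)//.
  have -> : (4 * eucl_const R) ^+ d = (e ^+ d) ^+ 2.
    by rewrite -exprM mulnC exprM sqr_sqrtr// ltW.
  rewrite sqrtr_sqr ger0_norm ?exprn_ge0 ?(ltW ep)// ler_pM2l ?exprn_gt0//.
  rewrite NE -powR12_sqrt ?powR_ge0// -powRrM le_eqVlt; apply/orP; left; apply/eqP.
  by congr (_ `^ _); field.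
have NpE : N%:R `^ (p_exp R d)^-1 = L%:R `^ ((d%:R + 1) ^+ 2 / 4).
  rewrite NE pE -powRrM; congr (_ `^ _); field; exact: dn0.
rewrite NpE in hDA.
(* The upper bound on [opnorm A] may be inserted only for D >= 0; a negative D would make D * opnorm
   A nonpositive, below a positive left side. *)
have D0 : 0 <= D.
  rewrite leNgt; apply/negP => Dn.
  have : 0 < D * opnorm A by apply: lt_le_trans hDA; exact: powR_gt0.
  by rewrite ltNge (mulr_le0_ge0 (ltW Dn) op0).
have key : L%:R `^ ((d%:R + 1) ^+ 2 / 4) <= D * e ^+ d * L%:R `^ (d%:R * (d%:R + 1) /
  4).
  by apply: le_trans hDA _; rewrite -mulrA ler_wpM2l.
have key2 : L%:R `^ (d%:R / 4) <= D * e ^+ d.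
  rewrite -(ler_pM2r (powR_gt0 (d%:R * (d%:R + 1) / 4) Lp)); apply: le_trans key.
  rewrite -powRD; last by rewrite (gt_eqF Lp) implybT.
  apply: ler_powR => //; nra.
rewrite expr_div_n ler_pdivrMr ?exprn_gt0// -powR_mulrn ?powR_ge0// -powRrM.
by rewrite mulrC.
Qed.

Lemma bh_growth_ge (K : nat) (x : R) : 0 <= x ->
  (forall d, (0 < d)%N -> ((x ^+ d)%:E <= bh_const R d K)%E) -> (x%:E <= bh_growth R
    K)%E.
Proof.
move=> x0 hx; apply: le_ereal_inf_tmp => _ /= [V [N _ NV] <-].
(* A single index in each neighbourhood of infinity suffices; the successor ensures d > 0, so that
   the d-th root is genuine. *)
set d := N.+1; have dV : V d by apply: NV; rewrite /= /d.
apply: (@le_trans _ _ (poweR (bh_const R d K) d%:R^-1)); last by apply: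
  ereal_sup_ubound; exists d.
have -> : x%:E = poweR (x ^+ d)%:E d%:R^-1.
  by rewrite poweR_EFin -powR_mulrn// -powRrM divff ?powRr1// pnatr_eq0.
apply: gt0_ler_poweR; rewrite ?invr_ge0 ?ler0n ?hx//.
  by rewrite in_itv /= lee_fin exprn_ge0 ?leey.
by rewrite in_itv /= leey andbT (le_trans _ (hx d isT))// lee_fin exprn_ge0.
Qed.

End Main.

Theorem theorem3p12 (R : realType) :
  exists c : R, 0 < c /\
    forall K : nat, (2 <= K)%N ->
      ((c * (K%:R `^ 4^-1))%:E <= bh_growth R K)%E.
Proof.
set e := Num.sqrt (4 * eucl_const R).
have cp : 0 < 4 * eucl_const R by rewrite /eucl_const !mulr_gt0 ?exprn_gt0 ?mulr_gt0.
have ep : 0 < e by rewrite sqrtr_gt0.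
have p0 : 0 < (128^-1 : R) `^ 4^-1 by rewrite powR_gt0// invr_gt0.
(* L > K / 128 produces the factor 128^(-1/4), and e is the loss per degree in the operator norm. *)
exists ((128^-1 : R) `^ 4^-1 / e); split; first by rewrite divr_gt0.
move=> K K2; apply: bh_growth_ge; first by rewrite mulr_ge0 ?powR_ge0// ltW// divr_gt0.
move=> d d0; apply: le_trans (bh_const_ge R K2 d0).
rewrite lee_fin; apply: lerXn2r; rewrite ?nnegrE ?mulr_ge0 ?powR_ge0 ?invr_ge0 ?(ltW
  ep)//.
rewrite -/e mulrAC ler_pM2r ?invr_gt0// -powRM ?invr_ge0 ?ler0n//.
apply: ge0_ler_powR; rewrite ?invr_ge0 ?nnegrE ?mulr_ge0 ?invr_ge0 ?ler0n//.
rewrite mulrC ler_pdivrMr// -natrM ler_nat.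
by apply: ltnW; rewrite ltn_ceil.
Qed.
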